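(* Let $E=x\partial_x+y\partial_y$ and $\pi=(E+x\partial_y)\wedge\partial_z$ on $\mathbb{R}^3$. The Poisson cohomology groups $H^\bullet(\mathbb{R}^3,\pi)$ are uniquely characterized by the following representatives: - the Casimir functions are the constants, $H^0(\mathbb{R}^3,\pi)=\mathbb{R}$; - $H^1(\mathbb{R}^3,\pi)$ is a free module over the Casimir functions with generators the classes of $x\partial_y$ and $\partial_z$; - $H^2(\mathbb{R}^3,\pi)$ is a free module over the Casimir functions with one generator, the class of $y\,\partial_x\wedge\partial_z$; - $H^3(\mathbb{R}^3,\pi)=0$. All the algebraic structure (wedge product and Schouten–Nijenhuis bracket on $H^\bullet(\mathbb{R}^3,\pi)$) is trivial, with the exception of the module structure over the Casimir functions.
   Context: For a Poisson structure $\pi$ on a manifold $M$ (a bivector field with $[\pi,\pi]=0$, where $[\cdot,\cdot]$ is the Schouten–Nijenhuis bracket), the Poisson cohomology $H^\bullet(M,\pi)$ is the cohomology of the complex $(\mathfrak{X}^\bullet(M),d_\pi:=[\pi,\cdot])$ of smooth multivector fields. The wedge product and Schouten–Nijenhuis bracket descend to $H^\bullet(M,\pi)$. Coordinates on $\mathbb{R}^3$ are $(x,y,z)$. *)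

(* Defs.v *)
From HB Require Import structures.
From mathcomp Require Import all_boot all_order all_algebra.
From mathcomp Require Import all_classical all_reals all_analysis.
Import Order.TTheory GRing.Theory Num.Theory.
Import numFieldNormedType.Exports.

Set Implicit Arguments.
Unset Strict Implicit.
Unset Printing Implicit Defensive.

Local Open Scope ring_scope.
Local Open Scope quotient_scope.

Section SmoothFunctions.
Variables (R : realType) (n : nat).
Implicit Types f g : 'rV[R]_n -> R.

Definition partial_fun (i : 'I_n) f : 'rV[R]_n -> R :=
  fun p => 'D_(delta_mx ord0 i) f p.

Fixpoint is_Ck (k : nat) f : Prop :=
  continuous f /\
  if k is k'.+1 then
    forall i : 'I_n,
      (forall p, derivable f p (delta_mx ord0 i)) /\ is_Ck k' (partial_fun i f)
  else True.

Definition smooth : pred ('rV[R]_n -> R) :=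
  fun f => `[< forall k, is_Ck k f >].

Lemma smoothP f : reflect (forall k, is_Ck k f) (f \in smooth).
Proof. exact: asboolP. Qed.

Lemma is_Ck_cst k (c : R) : is_Ck k (cst c).
Proof.
elim: k c => [|k IH] c; split; try exact: cst_continuous; first by [].
move=> i; split; first by move=> p; exact: derivable_cst.
have -> : partial_fun i (cst c) = cst 0.
  by apply/funext => p; rewrite /partial_fun derive_cst.
exact: IH.
Qed.

Lemma is_Ck_add k f g : is_Ck k f -> is_Ck k g -> is_Ck k (f + g).
Proof.
elim: k f g => [|k IH] f g /= [cf hf] [cg hg].
  by split=> // p; exact: (continuousD (cf p) (cg p)).
split; first by move=> p; exact: (continuousD (cf p) (cg p)).
move=> i; have [df hf'] := hf i; have [dg hg'] := hg i.
split; first by move=> p; exact: derivableD.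
have -> : partial_fun i (f + g) = partial_fun i f + partial_fun i g.
  by apply/funext => p; rewrite /partial_fun deriveD.
exact: IH.
Qed.

Lemma is_Ck_opp k f : is_Ck k f -> is_Ck k (- f).
Proof.
elim: k f => [|k IH] f /= [cf hf].
  by split=> // p; exact: (continuousN (cf p)).
split; first by move=> p; exact: (continuousN (cf p)).
move=> i; have [df hf'] := hf i.
split; first by move=> p; exact: derivableN.
have -> : partial_fun i (- f) = - partial_fun i f.
  by apply/funext => p; rewrite /partial_fun deriveN.
exact: IH.
Qed.

Lemma is_Ck_pred k f : is_Ck k.+1 f -> is_Ck k f.
Proof.
elim: k f => [|k IH] f; first by case.
move=> [cf hf]; split=> // i; have [df hf'] := hf i.
by split=> //; exact: IH.
Qed.

Lemma is_Ck_mul k f g : is_Ck k f -> is_Ck k g -> is_Ck k (f * g).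
Proof.
elim: k f g => [|k IH] f g hf hg.
  move: hf hg => [cf hf] [cg hg].
  by split=> // p; exact: (continuousM (cf p) (cg p)).
have hf1 := is_Ck_pred hf; have hg1 := is_Ck_pred hg.
move: hf hg => [cf hf] [cg hg].
split; first by move=> p; exact: (continuousM (cf p) (cg p)).
move=> i; have [df hf'] := hf i; have [dg hg'] := hg i.
split; first by move=> p; exact: derivableM.
have -> : partial_fun i (f * g) = f * partial_fun i g + g * partial_fun i f.
  by apply/funext => p; rewrite /partial_fun deriveM.
by apply: is_Ck_add; exact: IH.
Qed.

Lemma smooth_subring_closed : subring_closed smooth.
Proof.
split.
- by apply/smoothP => k; exact: is_Ck_cst.
- move=> f g /smoothP hf /smoothP hg; apply/smoothP => k.
  by apply: is_Ck_add => //; exact: is_Ck_opp.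
- move=> f g /smoothP hf /smoothP hg; apply/smoothP => k.
  exact: is_Ck_mul.
Qed.
HB.instance Definition _ :=
  GRing.isSubringClosed.Build _ smooth smooth_subring_closed.

Record Cinf := MkCinf {
  Cinf_fun :> 'rV[R]_n -> R;
  Cinf_smooth : Cinf_fun \in smooth }.
HB.instance Definition _ := [isSub for Cinf_fun].
HB.instance Definition _ := [Choice of Cinf by <:].
HB.instance Definition _ := [SubChoice_isSubComNzRing of Cinf by <:].

Lemma partial_smooth i f : f \in smooth -> partial_fun i f \in smooth.
Proof. by move=> /smoothP hf; apply/smoothP => k; case: (hf k.+1) => _ /(_ i)[]. Qed.

Definition partial (i : 'I_n) (f : Cinf) : Cinf :=
  MkCinf (partial_smooth i (Cinf_smooth f)).

Lemma cst_smooth (c : R) : (cst c : 'rV[R]_n -> R) \in smooth.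
Proof. by apply/smoothP => k; exact: is_Ck_cst. Qed.

Definition constf (c : R) : Cinf := MkCinf (cst_smooth c).

Lemma coord_deriv (i j : 'I_n) :
  (forall p : 'rV[R]_n, derivable (fun q : 'rV[R]_n => q ord0 j) p (delta_mx ord0 i)) /\
  partial_fun i (fun q : 'rV[R]_n => q ord0 j) = cst (i == j)%:R.
Proof.
suff H (p : 'rV[R]_n) :
    is_derive p (delta_mx ord0 i) (fun q : 'rV[R]_n => q ord0 j) (i == j)%:R.
  split; first by move=> p; have [] := H p.
  by apply/funext => p; have [_] := H p.
have L : linear (fun q : 'rV[R]_n => q ord0 j) by move=> a u v; rewrite !mxE.
pose lf : {linear 'rV[R]_n -> R} := HB.pack (fun q : 'rV[R]_n => q ord0 j)
  (GRing.isLinear.Build _ _ _ _ _ L).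
have lc : continuous lf by exact: coord_continuous.
have dl : differentiable lf p by exact: linear_differentiable.
apply: DeriveDef; first exact: (diff_derivable dl).
by rewrite (deriveE _ dl) (diff_lin _ lc) /= mxE eqxx/= eq_sym.
Qed.

Lemma coord_smooth (j : 'I_n) :
  (fun q : 'rV[R]_n => q ord0 j) \in smooth.
Proof.
apply/smoothP => -[|k]; split; try exact: coord_continuous; first by [].
move=> i; have [d ->] := coord_deriv i j.
by split=> //; exact: is_Ck_cst.
Qed.

Definition coord (j : 'I_n) : Cinf := MkCinf (coord_smooth j).

Lemma partialD i (f g : Cinf) : partial i (f + g) = partial i f + partial i g.
Proof.
apply/val_inj/funext => p /=; rewrite /partial_fun deriveD //.
- by have /smoothP/(_ 1%N)[_ /(_ i)[]] := Cinf_smooth f.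
- by have /smoothP/(_ 1%N)[_ /(_ i)[]] := Cinf_smooth g.
Qed.

Lemma partialM i (f g : Cinf) :
  partial i (f * g) = f * partial i g + partial i f * g.
Proof.
rewrite [X in _ + X]mulrC; apply/val_inj/funext => p.
change (partial_fun i (f * g : Cinf) p
        = (f * partial i g : Cinf) p + (g * partial i f : Cinf) p).
rewrite /partial_fun deriveM //.
- by have /smoothP/(_ 1%N)[_ /(_ i)[]] := Cinf_smooth f.
- by have /smoothP/(_ 1%N)[_ /(_ i)[]] := Cinf_smooth g.
Qed.

Lemma partial_coord i j : partial i (coord j) = (i == j)%:R.
Proof.
have -> : partial i (coord j) = constf (i == j)%:R.
  by apply/val_inj; have [_] := coord_deriv i j.
by case: (i == j); apply/val_inj.
Qed.

End SmoothFunctions.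

(* Multivector fields on R^n, of all degrees: P I is the coefficient of        *)
(* \partial_i1 /\ ... /\ \partial_ik, where I = {i1 < ... < ik}.               *)
Definition multivector (R : realType) (n : nat) : Type :=
  {ffun {set 'I_n} -> Cinf R n}.
HB.instance Definition _ R n := GRing.Zmodule.on (multivector R n).

Section Module.
Variables (R : realType) (n : nat).
Implicit Types (f g : Cinf R n) (P Q : multivector R n).

Definition mv_scale f P : multivector R n := [ffun K => f * P K].

Lemma mv_scaleA f g P : mv_scale f (mv_scale g P) = mv_scale (f * g) P.
Proof. by apply/ffunP => K; rewrite !ffunE mulrA. Qed.
Lemma mv_scale1 : left_id 1 mv_scale.
Proof. by move=> P; apply/ffunP => K; rewrite ffunE mul1r. Qed.
Lemma mv_scaleDr : right_distributive mv_scale +%R.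
Proof. by move=> f P Q; apply/ffunP => K; rewrite !ffunE mulrDr. Qed.
Lemma mv_scaleDl P : {morph mv_scale^~ P : f g / f + g}.
Proof. by move=> f g; apply/ffunP => K; rewrite !ffunE mulrDl. Qed.
HB.instance Definition _ := GRing.Zmodule_isLmodule.Build (Cinf R n)
  (multivector R n) mv_scaleA mv_scale1 mv_scaleDr mv_scaleDl.

Lemma mv_scaleE f P K : (f *: P) K = f * P K.
Proof. exact: ffunE. Qed.

End Module.

Definition basis_mv (R : realType) (n : nat) (I : {set 'I_n}) :
  multivector R n := [ffun K : {set 'I_n} => (K == I)%:R].

Section Multivectors.
Variables (R : realType) (n : nat).
Local Notation A := (Cinf R n).
Local Notation MV := (multivector R n).
Implicit Types (f g : A) (P Q : MV) (I J K : {set 'I_n}) (i j : 'I_n).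

Definition homog (k : nat) P : Prop := forall I, #|I| != k -> P I = 0.

Lemma basis_mvE I K : basis_mv R I K = (K == I)%:R.
Proof. exact: ffunE. Qed.

Definition fun_mv f : MV := f *: basis_mv R finset.set0.

Definition pd i : MV := basis_mv R [set i].

(* (-1) ^+ inversions I J is the sign of the permutation sorting I ++ J. *)
Definition inversions I J : nat := (\sum_(i in I) \sum_(j in J) (j < i))%N.

Definition wedge P Q : MV :=
  [ffun K : {set 'I_n} => \sum_(I : {set 'I_n} | I \subset K)
     (-1) ^+ inversions I (K :\: I) * (P I * Q (K :\: I))].

Definition partial_mv i P : MV := [ffun K : {set 'I_n} => partial i (P K)].

(* Left and right derivatives with respect to the odd variable \partial_i:     *)
(* \partial_i is moved to the front, resp. to the back, and removed.           *)
Definition lcontr i P : MV :=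
  [ffun K : {set 'I_n} => if i \in K then 0
             else (-1) ^+ inversions [set i] K * P (i |: K)].
Definition rcontr i P : MV :=
  [ffun K : {set 'I_n} => if i \in K then 0
             else (-1) ^+ inversions K [set i] * P (i |: K)].

(* The Schouten-Nijenhuis bracket, with the convention                         *)
(*   [X1 /\ .. /\ Xp, Y1 /\ .. /\ Yq]                                          *)
(*     = \sum_(i, j) (-1)^(i + j) [Xi, Yj] /\ X1 .. ^Xi .. Xp                  *)
(*                                         /\ Y1 .. ^Yj .. Yq,                 *)
(*   [X, f] = X f for a vector field X and a function f.                       *)
(* If all factors are coordinate vector fields, except X1 = f \partial_i1 and  *)
(* Y1 = g \partial_j1, the summands with i, j > 1 vanish and the others give    *)
(* the formula below.                                                          *)
Definition schouten P Q : MV :=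
  \sum_i (wedge (rcontr i P) (partial_mv i Q)
          - wedge (partial_mv i P) (lcontr i Q)).

Lemma partial0 i : partial i (0 : A) = 0.
Proof. by apply: (@addrI _ (partial i 0)); rewrite -partialD !addr0. Qed.

Lemma partialN i f : partial i (- f) = - partial i f.
Proof. by apply/eqP; rewrite -addr_eq0 -partialD addNr partial0. Qed.

Lemma partial_nat i m : partial i (m%:R : A) = 0.
Proof.
have p1 : partial i (1 : A) = 0.
  apply: (@addrI _ (partial i 1)); rewrite addr0.
  by have := partialM i (1 : A) 1; rewrite !mulr1 mul1r => <-.
by elim: m => [|m IH]; rewrite ?partial0// mulrS partialD p1 IH addr0.
Qed.

Lemma partial_sign i m f : partial i ((-1) ^+ m * f) = (-1) ^+ m * partial i f.
Proof.
by rewrite -signr_odd; case: odd; rewrite ?expr0 ?expr1 ?mul1r// !mulN1r partialN.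
Qed.

Lemma partial_sum i (T : finType) (S : pred T) (F : T -> A) :
  partial i (\sum_(t | S t) F t) = \sum_(t | S t) partial i (F t).
Proof. exact: (big_morph _ (partialD i) (partial0 i)). Qed.

Lemma partial_mvD i P Q : partial_mv i (P + Q) = partial_mv i P + partial_mv i Q.
Proof. by apply/ffunP => K; rewrite !ffunE partialD. Qed.

Lemma partial_mvN i P : partial_mv i (- P) = - partial_mv i P.
Proof. by apply/ffunP => K; rewrite !ffunE partialN. Qed.

Lemma partial_mvZ i f P :
  partial_mv i (f *: P) = f *: partial_mv i P + partial i f *: P.
Proof. by apply/ffunP => K; rewrite !(mv_scaleE, ffunE) partialM. Qed.

Lemma partial_mv_basis i I : partial_mv i (basis_mv R I) = 0.
Proof. by apply/ffunP => K; rewrite !ffunE ?basis_mvE partial_nat. Qed.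

Lemma lcontrD i P Q : lcontr i (P + Q) = lcontr i P + lcontr i Q.
Proof.
by apply/ffunP => K; rewrite !ffunE; case: ifP; rewrite ?addr0 // mulrDr.
Qed.

Lemma lcontrZ i f P : lcontr i (f *: P) = f *: lcontr i P.
Proof.
apply/ffunP => K; rewrite !(mv_scaleE, ffunE); case: ifP; rewrite ?mulr0 // => _.
by rewrite mulrCA.
Qed.

Lemma lcontrN i P : lcontr i (- P) = - lcontr i P.
Proof. by rewrite -scaleN1r lcontrZ scaleN1r. Qed.

Lemma lcontr_fun i f : lcontr i (fun_mv f) = 0.
Proof.
apply/ffunP => K; rewrite /fun_mv !(mv_scaleE, ffunE) ?basis_mvE; case: ifP => // _.
have -> : (i |: K == finset.set0) = false.
  by apply/negP => /eqP/finset.setP/(_ i); rewrite !inE eqxx.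
by rewrite !mulr0.
Qed.

Lemma wedgeDr P Q1 Q2 : wedge P (Q1 + Q2) = wedge P Q1 + wedge P Q2.
Proof.
apply/ffunP => K; rewrite !ffunE -big_split /=; apply: eq_bigr => I _.
by rewrite ffunE !mulrDr.
Qed.

Lemma wedgeDl P1 P2 Q : wedge (P1 + P2) Q = wedge P1 Q + wedge P2 Q.
Proof.
apply/ffunP => K; rewrite !ffunE -big_split /=; apply: eq_bigr => I _.
by rewrite ffunE mulrDl mulrDr.
Qed.

Lemma wedgeZr f P Q : wedge P (f *: Q) = f *: wedge P Q.
Proof.
apply/ffunP => K; rewrite mv_scaleE !ffunE mulr_sumr; apply: eq_bigr => I _.
by rewrite mv_scaleE [P I * _]mulrCA [LHS]mulrCA.
Qed.

Lemma wedgeZl f P Q : wedge (f *: P) Q = f *: wedge P Q.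
Proof.
apply/ffunP => K; rewrite mv_scaleE !ffunE mulr_sumr; apply: eq_bigr => I _.
by rewrite mv_scaleE -mulrA [LHS]mulrCA.
Qed.

Lemma wedge0l Q : wedge 0 Q = 0.
Proof. by rewrite -[X in wedge X](scale0r 0) wedgeZl scale0r. Qed.

Lemma wedge0r P : wedge P 0 = 0.
Proof. by rewrite -[X in wedge _ X](scale0r 0) wedgeZr scale0r. Qed.

Lemma wedge_suml (T : finType) (F : T -> MV) Q :
  wedge (\sum_t F t) Q = \sum_t wedge (F t) Q.
Proof. exact: (big_morph (wedge^~ Q) (fun x y => wedgeDl x y Q) (wedge0l Q)). Qed.

Lemma wedge_fun P f : wedge P (fun_mv f) = f *: P.
Proof.
rewrite wedgeZr; congr (_ *: _); apply/ffunP => K; rewrite ffunE.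
rewrite (bigD1 K) //= big1 => [|I /andP[sIK nIK]]; last first.
  rewrite basis_mvE finset.setD_eq0; case: (boolP (K \subset I)) => [sKI|_].
    by rewrite finset.eqEsubset sIK sKI in nIK.
  by rewrite !mulr0.
rewrite addr0 finset.setDv basis_mvE eqxx mulr1.
by rewrite /inversions big1 ?expr0 ?mul1r // => i _; rewrite finset.big_set0.
Qed.

Lemma partial_wedge i P Q :
  partial_mv i (wedge P Q) = wedge P (partial_mv i Q) + wedge (partial_mv i P) Q.
Proof.
apply/ffunP => K; rewrite !ffunE partial_sum -big_split; apply: eq_bigr => I _ /=.
by rewrite partial_sign partialM mulrDr !ffunE.
Qed.

Lemma homog_wedge p q P Q :
  homog p P -> homog q Q -> homog (p + q) (wedge P Q).
Proof.
move=> hP hQ K nK; rewrite ffunE big1 // => I sIK.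
have [Ip|Ip] := eqVneq #|I| p; last by rewrite hP // mul0r mulr0.
rewrite hQ ?mulr0 //; apply: contra nK => /eqP <-.
by rewrite -Ip -(cardsID I K) (finset.setIidPr sIK).
Qed.

Lemma homogD k P Q : homog k P -> homog k Q -> homog k (P + Q).
Proof. by move=> hP hQ I nI; rewrite ffunE hP // hQ // addr0. Qed.

Lemma homogZ k f P : homog k P -> homog k (f *: P).
Proof. by move=> hP I nI; rewrite mv_scaleE hP // mulr0. Qed.

Lemma homogN k P : homog k P -> homog k (- P).
Proof. by rewrite -scaleN1r; exact: homogZ. Qed.

Lemma homog0 k : homog k 0.
Proof. by move=> I _; rewrite ffunE. Qed.

Lemma homog_basis I : homog #|I| (basis_mv R I).
Proof. by move=> J; rewrite basis_mvE; case: (J =P I) => // ->; rewrite eqxx. Qed.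

Lemma homog_pd i : homog 1 (pd i).
Proof. by rewrite -(cards1 i); exact: homog_basis. Qed.

Lemma schoutenD P Q1 Q2 : schouten P (Q1 + Q2) = schouten P Q1 + schouten P Q2.
Proof.
rewrite /schouten -big_split; apply: eq_bigr => i _ /=.
by rewrite partial_mvD lcontrD !wedgeDr opprD addrACA.
Qed.

Lemma schouten_fun P f : schouten P (fun_mv f) = \sum_i partial i f *: rcontr i P.
Proof.
apply: eq_bigr => i _; rewrite lcontr_fun wedge0r subr0.
by rewrite partial_mvZ partial_mv_basis scaler0 add0r -/(fun_mv _) wedge_fun.
Qed.

Lemma schoutenZ P f Q :
  schouten P (f *: Q) = f *: schouten P Q + wedge (schouten P (fun_mv f)) Q.
Proof.
rewrite schouten_fun wedge_suml scaler_sumr -big_split; apply: eq_bigr => i _ /=.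
rewrite partial_mvZ lcontrZ wedgeDr !wedgeZr wedgeZl scalerBr.
by rewrite addrAC.
Qed.

Lemma schouten_cst P (c : R) : schouten P (fun_mv (constf _ c)) = 0.
Proof.
rewrite schouten_fun big1 // => i _.
suff -> : partial i (constf n c) = 0 by rewrite scale0r.
by apply/val_inj/funext => p /=; rewrite /partial_fun derive_cst.
Qed.

Lemma schouten0 P : schouten P 0 = 0.
Proof. by apply: (@addrI _ (schouten P 0)); rewrite -schoutenD !addr0. Qed.

Lemma schoutenN P Q : schouten P (- Q) = - schouten P Q.
Proof.
by apply/eqP; rewrite -addr_eq0 -schoutenD addNr schouten0.
Qed.

End Multivectors.

Record poisson (R : realType) (n : nat) := Poisson {
  bivector :> multivector R n;
  poisson_homog : homog 2 bivector;
  poisson_schouten : schouten bivector bivector = 0 }.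

Section Cohomology.
Variables (R : realType) (n : nat) (pi : poisson R n).
Local Notation A := (Cinf R n).
Local Notation MV := (multivector R n).

Definition dpi (P : MV) : MV := schouten pi P.

Definition is_casimir : pred A := fun f => `[< dpi (fun_mv f) = 0 >].

Lemma is_casimirP f : reflect (dpi (fun_mv f) = 0) (f \in is_casimir).
Proof. exact: asboolP. Qed.

Lemma casimir_subring_closed : subring_closed is_casimir.
Proof.
have fD (f g : A) : fun_mv (f + g) = fun_mv f + fun_mv g by exact: scalerDl.
have fN (f : A) : fun_mv (- f) = - fun_mv f by exact: scaleNr.
have fM (f g : A) : fun_mv (f * g) = f *: fun_mv g by rewrite [RHS]scalerA.
split=> [|f g /is_casimirP hf /is_casimirP hg|f g /is_casimirP hf /is_casimirP hg];
  apply/is_casimirP; rewrite /dpi.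
- rewrite -[RHS](schouten_cst pi 1); congr (schouten _ (fun_mv _)).
  exact/val_inj.
- by move: hf hg; rewrite /dpi fD schoutenD fN schoutenN => -> ->; rewrite subr0.
- by move: hf hg; rewrite /dpi fM schoutenZ => -> ->; rewrite wedge0l scaler0 addr0.
Qed.
HB.instance Definition _ :=
  GRing.isSubringClosed.Build _ is_casimir casimir_subring_closed.

Record casimir := Casimir {
  casimir_fun :> A;
  casimirP : casimir_fun \in is_casimir }.
HB.instance Definition _ := [isSub for casimir_fun].
HB.instance Definition _ := [Choice of casimir by <:].
HB.instance Definition _ := [SubChoice_isSubComNzRing of casimir by <:].

Definition is_cocycle (k : nat) : pred MV :=
  fun P => `[< homog k P /\ dpi P = 0 >].

Lemma cocycle_zmod_closed k : zmod_closed (is_cocycle k).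
Proof.
split; first by apply/asboolP; split; [exact: homog0|exact: schouten0].
move=> P Q /asboolP[hP dP] /asboolP[hQ dQ]; apply/asboolP; split.
  by apply: homogD => //; exact: homogN.
by move: dP dQ; rewrite /dpi schoutenD schoutenN => -> ->; rewrite subrr.
Qed.
HB.instance Definition _ k :=
  GRing.isZmodClosed.Build _ (is_cocycle k) (cocycle_zmod_closed k).

Record cocycle (k : nat) := Cocycle {
  cocycle_mv :> MV;
  cocycleP : cocycle_mv \in is_cocycle k }.
HB.instance Definition _ k := [isSub for @cocycle_mv k].
HB.instance Definition _ k := [Choice of cocycle k by <:].
HB.instance Definition _ k := [SubChoice_isSubZmodule of cocycle k by <:].

(* In degree 0, there are no nonzero coboundaries. *)
Definition coboundary_mv (k : nat) (P : MV) : Prop :=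
  if k is k'.+1 then exists2 Q : MV, homog k' Q & P = dpi Q else P = 0.

Definition is_coboundary (k : nat) : pred (cocycle k) :=
  fun Z => `[< coboundary_mv k Z >].

Lemma coboundary_zmod_closed k : zmod_closed (@is_coboundary k).
Proof.
split; first by apply/asboolP; case: k => //= k; exists 0;
  [exact: homog0|rewrite /dpi schouten0].
move=> P Q /asboolP hP /asboolP hQ; apply/asboolP.
case: k P Q hP hQ => [|k] P Q /=; first by move=> -> ->; rewrite subrr.
move=> [P' hP' ->] [Q' hQ' ->]; exists (P' - Q').
  by apply: homogD => //; exact: homogN.
by rewrite /dpi schoutenD schoutenN.
Qed.
HB.instance Definition _ k :=
  GRing.isZmodClosed.Build _ (@is_coboundary k) (@coboundary_zmod_closed k).

Definition coboundaries k : zmodClosed (cocycle k) :=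
  GRing.ZmodClosed.clone _ (@is_coboundary k) _.

Definition cohomology (k : nat) : Type := Quotient.quot (coboundaries k).
HB.instance Definition _ k := GRing.Zmodule.on (cohomology k).
HB.instance Definition _ k := ZmodQuotient.on (cohomology k).

Definition coclass k (Z : cocycle k) : cohomology k := \pi_(cohomology k) Z.

Lemma cocycle_scale k (c : casimir) (Z : cocycle k) : (c : A) *: (Z : MV) \in is_cocycle k.
Proof.
have /asboolP[hZ dZ] := cocycleP Z; apply/asboolP; split; first exact: homogZ.
have /is_casimirP := casimirP c.
by move: dZ; rewrite /dpi schoutenZ => -> ->; rewrite scaler0 wedge0l addr0.
Qed.

Definition cocycle_act k (c : casimir) (Z : cocycle k) : cocycle k :=
  Cocycle (cocycle_scale c Z).

Definition coho_scale k (c : casimir) (a : cohomology k) : cohomology k :=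
  coclass (cocycle_act c (repr a)).

Lemma coclass_eq k (Z Z' : cocycle k) :
  coclass Z = coclass Z' <-> coboundary_mv k (Z - Z').
Proof.
rewrite /coclass; split.
  by move/eqP; rewrite -Quotient.idealrBE => /asboolP.
by move=> h; apply/eqP; rewrite -Quotient.idealrBE; apply/asboolP.
Qed.

Lemma coclass_surj k (a : cohomology k) : coclass (repr a) = a.
Proof. exact: reprK. Qed.

Lemma coclassD k : {morph @coclass k : Z Z' / Z + Z' >-> Z + Z'}.
Proof. by move=> Z Z'; rewrite /coclass piE. Qed.

Lemma coboundary_act k (c : casimir) (P : MV) :
  coboundary_mv k P -> coboundary_mv k ((c : A) *: P).
Proof.
case: k => [->|k [Q hQ ->]] /=; first by rewrite scaler0.
exists ((c : A) *: Q); first exact: homogZ.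
have /is_casimirP := casimirP c.
by rewrite /dpi schoutenZ => ->; rewrite wedge0l addr0.
Qed.

Lemma coclass_act k (c : casimir) (Z : cocycle k) :
  coho_scale c (coclass Z) = coclass (cocycle_act c Z).
Proof.
apply/coclass_eq; have /coclass_eq/(coboundary_act c) := coclass_surj (coclass Z).
by rewrite /= scalerBr.
Qed.

Lemma cocycle_actA k (b c : casimir) (Z : cocycle k) :
  cocycle_act b (cocycle_act c Z) = cocycle_act (b * c) Z.
Proof. by apply/val_inj; rewrite /= scalerA. Qed.
Lemma cocycle_act1 k : left_id 1 (@cocycle_act k).
Proof. by move=> Z; apply/val_inj; rewrite /= scale1r. Qed.
Lemma cocycle_actDr k : right_distributive (@cocycle_act k) +%R.
Proof. by move=> c Y Z; apply/val_inj; rewrite /= scalerDr. Qed.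
Lemma cocycle_actDl k (Z : cocycle k) :
  {morph (@cocycle_act k)^~ Z : b c / b + c}.
Proof. by move=> b c; apply/val_inj; rewrite /= scalerDl. Qed.

Lemma coho_scaleA k (b c : casimir) (a : cohomology k) :
  coho_scale b (coho_scale c a) = coho_scale (b * c) a.
Proof. by rewrite -(coclass_surj a) !coclass_act cocycle_actA. Qed.
Lemma coho_scale1 k : left_id 1 (@coho_scale k).
Proof. by move=> a; rewrite -(coclass_surj a) coclass_act cocycle_act1. Qed.
Lemma coho_scaleDr k : right_distributive (@coho_scale k) +%R.
Proof.
move=> c a b; rewrite -(coclass_surj a) -(coclass_surj b) -coclassD !coclass_act.
by rewrite -coclassD cocycle_actDr.
Qed.
Lemma coho_scaleDl k (a : cohomology k) :
  {morph (@coho_scale k)^~ a : b c / b + c}.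
Proof.
move=> b c; rewrite -(coclass_surj a) !coclass_act -coclassD.
by rewrite cocycle_actDl.
Qed.
HB.instance Definition _ k := GRing.Zmodule_isLmodule.Build casimir (cohomology k)
  (@coho_scaleA k) (@coho_scale1 k) (@coho_scaleDr k) (@coho_scaleDl k).

(* a is the cohomology class of the multivector field P (in particular, P is a *)
(* cocycle of degree k).                                                       *)
Definition represents (k : nat) (a : cohomology k) (P : MV) : Prop :=
  exists2 Z : cocycle k, (Z : MV) = P & coclass Z = a.

End Cohomology.

Definition is_basis (K : pzRingType) (V : lmodType K) (e : seq V) : Prop :=
  forall v : V,
    exists! c : {ffun 'I_(size e) -> K}, v = \sum_(i < size e) c i *: e`_i.

Section PoissonR3.
Variable R : realType.
Local Notation MV := (multivector R 3).

Local Notation i0 := (@Ordinal 3 0 isT).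
Local Notation i1 := (@Ordinal 3 1 isT).
Local Notation i2 := (@Ordinal 3 2 isT).

Definition cx : Cinf R 3 := coord R i0.
Definition cy : Cinf R 3 := coord R i1.
Definition dx : MV := pd R i0.
Definition dy : MV := pd R i1.
Definition dz : MV := pd R i2.

Definition Euler : MV := cx *: dx + cy *: dy.

Definition pi3_bivector : MV := wedge (Euler + cx *: dy) dz.

Definition contains_dz (P : MV) := forall K : {set 'I_3}, i2 \notin K -> P K = 0.

Lemma wedge_contains_dz P Q :
  contains_dz P -> contains_dz Q -> wedge P Q = 0.
Proof.
move=> hP hQ; apply/ffunP => K; rewrite !ffunE big1 // => I sIK.
have [zI|zI] := boolP (i2 \in I); last by rewrite hP // mul0r mulr0.
by rewrite hQ ?mulr0 // !inE zI.
Qed.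

Lemma contains_dz_wedge P : contains_dz (wedge P dz).
Proof.
move=> K zK; rewrite ffunE big1 // => I sIK; rewrite [dz _]basis_mvE.
have -> : (K :\: I == [set i2]) = false.
  apply/negP => /eqP/finset.setP/(_ i2).
  by rewrite !inE eqxx (negbTE zK) andbF.
by rewrite !mulr0.
Qed.

Lemma pi3_homog : homog 2 pi3_bivector.
Proof.
apply: (@homog_wedge _ _ 1 1); last exact: homog_pd.
by do ?apply: homogD; apply: homogZ; exact: homog_pd.
Qed.

Lemma pi3_schouten : schouten pi3_bivector pi3_bivector = 0.
Proof.
rewrite /schouten big1 // => i _; have [->|iz] := eqVneq i i2.
  suff -> : partial_mv i2 pi3_bivector = 0 by rewrite wedge0l wedge0r subr0.
  rewrite partial_wedge partial_mv_basis wedge0r add0r.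
  rewrite !partial_mvD !partial_mvZ !partial_mv_basis !partial_coord.
  by rewrite /= !scaler0 !scale0r !addr0 wedge0l.
have hp := @contains_dz_wedge (Euler + cx *: dy).
have hd : contains_dz (partial_mv i pi3_bivector).
  by move=> K zK; rewrite ffunE hp // partial0.
have zi (K : {set 'I_3}) : i2 \notin K -> i2 \notin i |: K.
  by rewrite !inE negb_or eq_sym iz.
rewrite !wedge_contains_dz ?subr0 // => K zK; rewrite ffunE; case: ifP => // _;
  by rewrite hp ?mulr0 // zi.
Qed.

Definition pi3 : poisson R 3 := Poisson pi3_homog pi3_schouten.

End PoissonR3.

(* Main.v *)
Require Import Defs.
From HB Require Import structures.
From mathcomp Require Import all_boot all_order all_algebra.
From mathcomp Require Import all_classical all_reals all_analysis.
From mathcomp Require Import zify ring lra.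
Import Order.TTheory GRing.Theory Num.Theory.
Import numFieldNormedType.Exports.

(* Write pi = V /\ d_z with V = x d_x + (x + y) d_y, a linear field without z.  *)
(* Since V has only the eigenvalue 1, the flow phi_t of V contracts as t tends  *)
(* to -oo, and V + 1 acting on smooth functions has the inverse                 *)
(* f |-> \int_(-oo)^0 e^t (f o phi_t) dt = \int_0^1 f o phi_(ln s) ds.          *)
(* Combined with Hadamard's lemma f = f(0, 0, z) + x f_1 + y f_2, this solves   *)
(* V l = f and (V - 1) a = g up to finitely many Taylor coefficients at the     *)
(* origin, which are the classes in the theorem.  The dependence on z is        *)
(* removed beforehand: a vector field Y with V /\ Y = 0 is a multiple h V, and  *)
(* the z-antiderivatives of h provide gauge transformations.                    *)
(* By the Leibniz and Jacobi identities, products and brackets of classes       *)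
(* reduce to those of the representatives, whose primitives are explicit.       *)

Set Implicit Arguments.
Unset Strict Implicit.
Unset Printing Implicit Defensive.

Local Open Scope ring_scope.

(** In components, d sends f to (x f_z, (x + y) f_z, -V f), a vector field (a, b, c) to the bivector
    with coefficients x b_z - (x + y) a_z, V a - a + x c_z, V b - a - b + (x + y) c_z on d_x d_y,
    d_x d_z, d_y d_z, and a bivector (p, q, r) to x r_z - (x + y) q_z - V p + 2 p ([dpi3_bset]).

    Once the z-dependence is gauged away, what remains is V acting on functions of (x, y) and ad V
    acting on planar vector fields. On functions homogeneous of degree j the only eigenvalue of V is
    j, and on planar fields with such coefficients the only eigenvalue of ad V is j - 1. So the
    obstructions sit in the constants and in the linear fields, where V is a Jordan block.
    [planar_lie_surj], [planar_lie_sub1_surj] and [planar_lie_kernel] make this precise for smooth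
    functions, with [resolvent] in place of power series.

    Degree 1 ([H1_normal_form]): the planar fields commuting with V are spanned by V and x d_y;
    since V = d(z), only x d_y survives, and the constants modulo the image of V give d_z. Degree 2
    ([H2_normal_form]): the cokernel of ad V is spanned by V and y d_x; since V wedge d_z = d(z
    d_z), only y d_x wedge d_z survives. Degree 3 ([H3_normal_form]): every top coefficient is hit,
    because the term 2 p reaches the values on the z-axis and the other terms reach everything that
    vanishes there. Independence of the classes follows by comparing first-order Taylor coefficients
    at 0 ([coboundary1_eq0], [coboundary2_eq0]).

    Since degree 3 is exact, products need a check only in degrees (1, 1), and brackets only in
    degrees (1, 1), (1, 2) and (2, 1). There the primitives are given by [wedge_normal1],
    [schouten_normal1] and [schouten_normal1_ydxdz]. *)

Local Notation coord := Defs.coord.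
Local Notation i0 := (@Ordinal 3 0 isT).
Local Notation i1 := (@Ordinal 3 1 isT).
Local Notation i2 := (@Ordinal 3 2 isT).

(** * Differentiability of C^1 functions *)

Section FrechetDerivative.
Local Open Scope classical_set_scope.
Variables (R : realType) (n : nat).
Implicit Types (f : 'rV[R]_n -> R) (p q u v : 'rV[R]_n).

Local Notation ei i := (delta_mx ord0 i : 'rV[R]_n).

Lemma is_derive_line f q v (t : R) : derivable f (q + t *: v) v ->
  is_derive t 1 (fun s : R => f (q + s *: v)) ('D_v f (q + t *: v)).
Proof.
move=> df.
have E : (fun h : R => h^-1 *: (f (q + (h *: 1 + t) *: v) - f (q + t *: v)))
    = (fun h : R => h^-1 *: (f (h *: v + (q + t *: v)) - f (q + t *: v))).
  apply/funext => h; congr (_ *: (f _ - _)).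
  by rewrite addrCA -scalerDl [h *: 1]mulr1.
by apply: DeriveDef; rewrite /derivable /derive E.
Qed.

(** The mean value theorem along a coordinate line, for a derivative that stays within e of c. *)
Lemma line_increment f q (i : 'I_n) (c e a b : R) :
    (forall r, derivable f r (ei i)) ->
    (forall t, Num.min a b <= t <= Num.max a b ->
       `|partial_fun i f (q + t *: ei i) - c| <= e) ->
  `|f (q + b *: ei i) - f (q + a *: ei i) - (b - a) * c| <= e * `|b - a|.
Proof.
move=> df; wlog ab : a b / a <= b.
  move=> H; have [ab|ba] := orP (le_total a b); first exact: H.
  rewrite minC maxC => Hc; rewrite -normrN [`|b - a|]distrC.
  apply: le_trans (H _ _ ba Hc); rewrite le_eqVlt; apply/orP; left; apply/eqP.
  by congr (`|_|); ring.
rewrite (min_idPl ab) (max_idPr ab) => Hc.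
have dg (t : R) := is_derive_line (df (q + t *: ei i)).
have cg : {within `[a, b], continuous (fun s : R => f (q + s *: ei i))}.
  by apply: derivable_within_continuous => t _; case: (dg t).
have [t tab ->] := @MVT_segment _ _ (fun t => 'D_(ei i) f (q + t *: ei i))
  a b ab (fun t _ => dg t) cg.
rewrite [_ * (b - a)]mulrC -mulrBr normrM mulrC ler_wpM2r //.
by apply: Hc; move: tab; rewrite in_itv.
Qed.

Lemma normr_coord p (j : 'I_n) : `|p ord0 j| <= `|p|.
Proof. by rewrite [leRHS]mx_normrE; exact: (le_bigmax _ _ (ord0, j)). Qed.

(** Going from p to u + p one coordinate at a time splits the increment into n increments along
    coordinate lines; continuity of the partial derivatives at p controls each of them. *)
Lemma C1_increment f p (e : R) : is_Ck 1 f -> 0 < e ->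
  exists2 d : R, 0 < d & forall u, `|u| < d ->
    `|f (u + p) - f p - \sum_j u ord0 j * partial_fun j f p| <= e * `|u| *+ n.
Proof.
move=> [_ hf] e0.
have : \forall q \near p, forall j, `|partial_fun j f q - partial_fun j f p| <= e.
  near=> q => j; move: j; near: q; apply: filter_forall.
  move=> j; have [_ [cj _]] := hf j.
  have /cvgrPdist_le/(_ _ e0) := cj p; apply: filterS => q.
  by rewrite distrC.
move=> /nbhs_ballP[d d0 Hd]; exists d => // u ud.
(* The k-th corner of the path has its first k coordinates already moved. In the sup norm the whole
   path stays in the ball around p. *)
pose q (k : nat) := p + \row_(j < n) (if (j < k)%N then u ord0 j else 0).
have qn : q n = u + p.
  by rewrite addrC; congr (_ + _); apply/rowP => j; rewrite mxE ltn_ord.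
have q0 : q 0%N = p by rewrite /q; apply/rowP => j; rewrite !mxE addr0.
have step (j : 'I_n) :
    `|f (q j.+1) - f (q j) - u ord0 j * partial_fun j f p| <= e * `|u|.
  have -> : q j.+1 = q j + u ord0 j *: ei j.
    apply/rowP => k; rewrite !mxE eqxx /= ltnS leq_eqVlt -addrA; congr (_ + _).
    rewrite -val_eqE /=; case: ltngtP => // kj; rewrite ?mulr0 ?addr0 ?add0r //.
    by rewrite mulr1; congr (u _ _); exact/val_inj.
  have [_ [df _]] : True /\ ((forall r, derivable f r (ei j)) /\ True).
    by case: (hf j).
  have := @line_increment f (q j) j (partial_fun j f p) e 0 (u ord0 j) df.
  rewrite scale0r addr0 subr0 => H; apply: (le_trans (H _)); last first.
    by rewrite ler_wpM2l ?(ltW e0) // normr_coord.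
  move=> t tu; apply: Hd; rewrite -ball_normE /= /q -addrA opprD addNKr normrN.
  apply: le_lt_trans ud.
  rewrite [leLHS]mx_normrE; apply: bigmax_le => [|ok _]; first exact: normr_ge0.
  case: ok => i k /=.
  rewrite !mxE [i]ord1 eqxx /=.
  have [kj|kj] := ltnP k j.
    by rewrite -val_eqE /= (ltn_eqF kj) mulr0 addr0 normr_coord.
  rewrite add0r; case: (k == j) => /=; last by rewrite mulr0 normr0.
  rewrite mulr1; apply: le_trans (normr_coord u j).
  move: tu; have [u0|u0] := leP 0 (u ord0 j) => /andP[t0 t1].
    by rewrite !ger0_norm.
  by rewrite !ler0_norm ?lerN2 // ltW.
have -> : f (u + p) - f p = \sum_(j < n) (f (q j.+1) - f (q j)).
  by rewrite -qn -[X in _ - f X]q0 -(big_mkord xpredT (fun k => f (q k.+1) - f (q k))) telescope_sumr.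
rewrite -sumrB; apply: (le_trans (ler_norm_sum _ _ _)).
apply: (le_trans (ler_sum _ (fun j _ => step j))).
by rewrite sumr_const card_ord.
Unshelve. all: by end_near.
Qed.

(** [smooth] only speaks of directional derivatives along the axes; the chain rule along curves
    needs the full differential. *)
Lemma C1_differentiable f p : is_Ck 1 f ->
  differentiable f p /\
  forall v, 'd f p v = \sum_j v ord0 j * partial_fun j f p.
Proof.
move=> hf.
have L : linear (fun v => \sum_j v ord0 j * partial_fun j f p).
  move=> a u v; rewrite scaler_sumr -big_split; apply: eq_bigr => j _.
  by rewrite !mxE mulrDl -mulrA.
pose df : {linear 'rV[R]_n -> R} := HB.pack (fun v => \sum_j v ord0 j * partial_fun j f p)
  (GRing.isLinear.Build _ _ _ _ _ L).
have dfc : continuous df.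
  change (continuous (fun v : 'rV[R]_n => \sum_j v ord0 j * partial_fun j f p)).
  apply: continuous_big => [|j _]; first exact: add_continuous.
  move=> v; apply: (@continuousM R _ (fun v : 'rV[R]_n => v ord0 j) (fun=> partial_fun j f p) v).
    exact: coord_continuous.
  exact: cst_continuous.
have E : f \o shift p = cst (f p) + df +o_ (0 : 'rV[R]_n) id.
  apply/eqaddoP => e e0 /=.
  have n1 : 0 < (n.+1%:R : R) by [].
  have [d d0 Hd] := C1_increment p hf (divr_gt0 e0 n1).
  near=> u.
  rewrite /= -[X in `|X|]/(f (u + p) - (f p + df u)) opprD addrA.
  apply: (le_trans (Hd u _)).
    by near: u; apply/nbhs_ballP; exists d => // u; rewrite -ball_normE /= sub0r normrN.
  rewrite -mulr_natr -!mulrA ler_wpM2l ?(ltW e0) // mulrC.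
  by rewrite ler_pdivrMr // ler_wpM2l // ler_nat.
have dE := diff_unique dfc E.
split; last by move=> v; rewrite dE.
by apply/diff_locallyP; rewrite dE.
Unshelve. all: by end_near.
Qed.

End FrechetDerivative.

(** * Averages over paths of linear maps *)

Section ParametricIntegral.
Local Open Scope classical_set_scope.
Variables (R : realType) (T : topologicalType).
Local Notation mu := (@lebesgue_measure R).

Definition integral01 (g : R -> R) : R := \int[mu]_(s in `[0, 1]) g s.

Lemma integrable01 (g : R -> R) :
  continuous g -> mu.-integrable `[0, 1] (EFin \o g).
Proof.
move=> cg; apply: continuous_compact_integrable; first exact: segment_compact.
exact: continuous_subspaceT.
Qed.

Lemma mu01 : mu `[0, 1] = 1%E.
Proof. by rewrite lebesgue_measure_itv /= lte_fin ltr01 oppr0 adde0. Qed.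

Lemma integral01_le (g : R -> R) (e : R) : continuous g ->
  (forall s, 0 <= s <= 1 -> `|g s| <= e) -> `|integral01 g| <= e.
Proof.
move=> cg ge.
apply: (le_trans (le_normr_Rintegral _ (integrable01 cg))); first exact: measurable_itv.
have -> : e = \int[mu]_(s in `[0, 1]) (cst e s).
  rewrite Rintegral_cst; last exact: measurable_itv.
  by rewrite [X in fine X]mu01 mulr1.
apply: le_Rintegral; first exact: measurable_itv.
- apply: (@integrable01 (fun s => `|g s|)) => s.
  by apply: continuous_comp; [exact: cg|exact: norm_continuous].
- by apply: integrable01; exact: cst_continuous.
- by move=> s /=; rewrite in_itv /=; exact: ge.
Qed.

Variable g : T -> R -> R.
Hypothesis cg : continuous (fun ts : T * R => g ts.1 ts.2).

Lemma joint_continuousr t : continuous (g t).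
Proof.
move=> s; apply: (@continuous_comp _ _ _ (fun s : R => (t, s))
  (fun ts : T * R => g ts.1 ts.2)); last exact: cg.
exact: (cvg_pair (cvg_cst t) (@cvg_id _ (nbhs s))).
Qed.

(** The tube lemma: compactness of [0, 1] makes continuity in t uniform in s. *)
Lemma tube01 t0 (e : R) : 0 < e ->
  \forall t \near t0, forall s, 0 <= s <= 1 -> `|g t s - g t0 s| <= e.
Proof.
move=> e0; have /compact_near_coveringP cpt := @segment_compact R 0 1.
have H : \forall t \near t0, `[0, 1]%classic `<=` (fun s => `|g t s - g t0 s| <= e).
  apply: (cpt _ (nbhs t0) (fun t s => `|g t s - g t0 s| <= e)) => s0 _.
  have e2 : 0 < e / 2 by rewrite divr_gt0.
  have /cvgrPdist_le/(_ _ e2) c1 := @cg (t0, s0).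
  have /cvgrPdist_le/(_ _ e2) c2 := @joint_continuousr t0 s0.
  move: c1 => -[[A B] /= [tA sB] AB].
  exists (B `&` [set s | `|g t0 s0 - g t0 s| <= e / 2], A) => /=.
    by split=> //; exact: filterI.
  move=> [s t] /= [[Bs Cs] At].
  rewrite [e]splitr -[_ - _](subrKA (g t0 s0)) (le_trans (ler_normD _ _)) // lerD //.
  by rewrite distrC; exact: (AB (t, s)).
apply: filterS H => t H s s01; apply: H => /=; by rewrite in_itv.
Qed.

Lemma integral01_continuous : continuous (fun t => integral01 (g t)).
Proof.
move=> t0; apply/cvgrPdist_le => e e0.
apply: filterS (tube01 t0 e0) => t H.
rewrite -normrN opprB -RintegralB.
- apply: integral01_le => // s; apply: continuousB; exact: joint_continuousr.
- exact: measurable_itv.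
- by apply: integrable01; exact: joint_continuousr.
- by apply: integrable01; exact: joint_continuousr.
Qed.

End ParametricIntegral.

Section DerivativeUnderIntegral.
Local Open Scope classical_set_scope.

Lemma integral01_is_derive (R : realType) (g dg : R -> R -> R) (a : R) :
    (forall t, continuous (g t)) ->
    continuous (fun ts : R * R => dg ts.1 ts.2) ->
    (forall t s : R, is_derive t 1 (g ^~ s) (dg t s)) ->
  is_derive a 1 (fun t => integral01 (g t)) (integral01 (dg a)).
Proof.
move=> cg cdg dgE.
have cdga : continuous (dg a) := @joint_continuousr _ _ _ cdg a.
have /nbhs_ballP[d /= d0 Hd] := tube01 cdg a (@ltr01 R).
have Iball t : `]a - d, a + d[%classic t -> ball a d t.
  by rewrite /= in_itv /= -ball_normE /= ltr_distlC.
have Ia : `]a - d, a + d[%classic a.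
  by rewrite /= in_itv /= ltrBlDr ltrDl d0.
have p1 t s : partial1of2 g t s = dg t s.
  by rewrite partial1of2E; have [_] := dgE t s.
have m01 : measurable (`[0, 1]%classic : set (measurableTypeR R)).
  exact: measurable_itv.
(* An integrable bound for all t near a, obtained from [tube01] with e = 1. *)
pose G (s : measurableTypeR R) : R := `|dg a s| + 1.
have G0 s : 0 <= G s by rewrite addr_ge0.
have iG : (@lebesgue_measure R).-integrable `[0, 1] (EFin \o G).
  apply: integrable01 => s; rewrite /G; apply: cvgD; last exact: cvg_cst.
  by apply: continuous_comp; [exact: cdga|exact: norm_continuous].
have Gub t s : `]a - d, a + d[%classic t -> `[0, 1]%classic s ->
    `|partial1of2 g t s| <= G s.
  move=> /Iball tb; rewrite /= in_itv => s01; rewrite p1 /G addrC -lerBlDr.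
  exact: le_trans (lerB_dist _ _) (Hd _ tb _ s01).
have ig t : `]a - d, a + d[%classic t ->
    (@lebesgue_measure R).-integrable `[0, 1] (EFin \o g t).
  by move=> _; exact: integrable01.
have dg1 t s : `]a - d, a + d[%classic t -> `[0, 1]%classic s ->
    derivable (g^~ s) t 1.
  by move=> _ _; have [] := dgE t s.
apply: DeriveDef.
  exact: (derivable_under_integral m01 Ia ig dg1 G0 iG Gub).
rewrite -derive1E (differentiation_under_integral m01 Ia ig dg1 G0 iG Gub).
by apply: eq_Rintegral => s _; exact: p1.
Qed.

End DerivativeUnderIntegral.

Section MatrixContinuity.
Local Open Scope classical_set_scope.
Variables (R : realType) (T : topologicalType) (m n : nat).

Lemma continuous_mx (F : T -> 'M[R]_(m, n)) :
  (forall i j, continuous (fun x => F x i j)) -> continuous F.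
Proof.
move=> cF x; apply/cvgrPdist_le => e e0.
near=> y; rewrite [leLHS]mx_normrE.
apply: bigmax_le => [|k _]; first exact: ltW.
rewrite !mxE; move: k; near: y; apply: filter_forall => -[i j] /=.
exact: ((cvgrPdist_le _ _).1 (cF i j x)).
Unshelve. all: by end_near.
Qed.

End MatrixContinuity.

Section Integral01Linear.
Local Open Scope classical_set_scope.
Variable R : realType.
Implicit Types g h : R -> R.

Lemma eq_integral01 g h : (forall s, 0 <= s <= 1 -> g s = h s) ->
  integral01 g = integral01 h.
Proof.
by move=> gh; apply: eq_Rintegral => s; rewrite inE /= in_itv /=; exact: gh.
Qed.

Lemma integral01D g h : continuous g -> continuous h ->
  integral01 (fun s => g s + h s) = integral01 g + integral01 h.
Proof.
move=> cg ch; apply: RintegralD; first exact: measurable_itv.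
  exact: integrable01.
exact: integrable01.
Qed.

Lemma integral01Z (c : R) g : continuous g ->
  integral01 (fun s => c * g s) = c * integral01 g.
Proof.
move=> cg; apply: RintegralZl; first exact: measurable_itv.
exact: integrable01.
Qed.

Lemma integral01_0 : integral01 (fun=> 0 : R) = 0.
Proof.
by rewrite /integral01 Rintegral_cst ?mul0r //; exact: measurable_itv.
Qed.

Lemma integral01_sum (I : Type) (r : seq I) (F : I -> R -> R) :
  (forall i, continuous (F i)) ->
  integral01 (fun s => \sum_(i <- r) F i s) = \sum_(i <- r) integral01 (F i).
Proof.
move=> cF; elim: r => [|i r IH].
  by rewrite big_nil; under eq_integral01 do rewrite big_nil; exact: integral01_0.
rewrite big_cons -IH -integral01D //; last first.
  by apply: continuous_big => //; exact: add_continuous.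
by apply: eq_integral01 => s _; rewrite big_cons.
Qed.

Lemma integral01_FTC (g dg : R -> R) : continuous g -> continuous dg ->
  (forall s : R, 0 < s < 1 -> is_derive s 1 g (dg s)) ->
  integral01 dg = g 1 - g 0.
Proof.
move=> cg cdg dgE; rewrite /integral01 /Rintegral (@continuous_FTC2 _ dg g) //.
- exact: continuous_subspaceT.
- split.
  + by move=> s; rewrite in_itv /= => /dgE[].
  + by apply: cvg_at_right_filter; exact: cg.
  + by apply: cvg_at_left_filter; exact: cg.
- by move=> s; rewrite in_itv /= derive1E => /dgE[].
Qed.

End Integral01Linear.

Section ChainRule.
Local Open Scope classical_set_scope.
Variables (R : realType) (n : nat).

Lemma is_derive_curve (f : 'rV[R]_n -> R) (c dc : R -> 'rV[R]_n) (s : R) :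
  is_Ck 1 f -> (forall j, is_derive s 1 (fun t => c t ord0 j) (dc s ord0 j)) ->
  is_derive s 1 (fun t => f (c t)) (\sum_j dc s ord0 j * partial_fun j f (c s)).
Proof.
move=> hf hc.
have [df dfE] := C1_differentiable (c s) hf.
have dcs : derivable c s 1 by apply/derivable_mxP => i j; rewrite ord1; case: (hc j).
have diffc : differentiable c s by apply/derivable1_diffP.
have dfc : differentiable (f \o c) s by exact: differentiable_comp.
apply: DeriveDef; first exact: diff_derivable.
rewrite deriveE // diff_comp // /= dfE -deriveE // derive_mx //.
by apply: eq_bigr => j _; rewrite !mxE; congr (_ * _); case: (hc j).
Qed.

End ChainRule.

Section Averaging.
Local Open Scope classical_set_scope.
Variables (R : realType) (n : nat).
Implicit Types (w : R -> R) (M : R -> 'M[R]_n) (f : 'rV[R]_n -> R) (p : 'rV[R]_n).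

Definition mx_cont M := forall i j, continuous (fun s => M s i j).

(** The weight w makes this class of averages stable under partial derivatives: differentiating
    multiplies w by entries of M. Only continuity in s is asked of w and M, so that s ln s is
    admissible up to s = 0. *)
Definition avg_fun w M f p : R := integral01 (fun s => w s * f (p *m M s)).

Variable M : R -> 'M[R]_n.
Hypothesis cM : mx_cont M.

Lemma mulmx_joint_continuous :
  continuous (fun ps : 'rV[R]_n * R => ps.1 *m M ps.2).
Proof.
apply: continuous_mx => i j.
have -> : (fun ps : 'rV[R]_n * R => (ps.1 *m M ps.2) i j) =
          (fun ps => \sum_k ps.1 i k * M ps.2 k j).
  by apply/funext => ps; rewrite mxE.
apply: continuous_big => [|k _]; first exact: add_continuous.
move=> ps.
have c1 : {for ps, continuous (fun ps : 'rV[R]_n * R => ps.1 i k)}.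
  apply: (@continuous_comp _ _ _ fst (fun p : 'rV[R]_n => p i k)).
    exact: cvg_fst.
  exact: coord_continuous.
have c2 : {for ps, continuous (fun ps : 'rV[R]_n * R => M ps.2 k j)}.
  apply: (@continuous_comp _ _ _ snd (fun s => M s k j)); first exact: cvg_snd.
  exact: cM.
exact: (continuousM c1 c2).
Qed.

Lemma avg_joint_continuous w f : continuous w -> continuous f ->
  continuous (fun ps : 'rV[R]_n * R => w ps.2 * f (ps.1 *m M ps.2)).
Proof.
move=> cw cf ps.
have c1 : {for ps, continuous (fun ps : 'rV[R]_n * R => w ps.2)}.
  by apply: (@continuous_comp _ _ _ snd w); [exact: cvg_snd|exact: cw].
have c2 : {for ps, continuous (fun ps : 'rV[R]_n * R => f (ps.1 *m M ps.2))}.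
  apply: (@continuous_comp _ _ _ (fun ps : 'rV[R]_n * R => ps.1 *m M ps.2) f).
    exact: mulmx_joint_continuous.
  exact: cf.
exact: (continuousM c1 c2).
Qed.

Lemma avg_integrand_continuous w f p : continuous w -> continuous f ->
  continuous (fun s => w s * f (p *m M s)).
Proof.
move=> cw cf.
exact: (@joint_continuousr _ _ (fun p s => w s * f (p *m M s))
  (avg_joint_continuous cw cf)).
Qed.

Lemma avg_fun_continuous w f : continuous w -> continuous f ->
  continuous (avg_fun w M f).
Proof.
move=> cw cf.
exact: (@integral01_continuous _ _ (fun p s => w s * f (p *m M s))
  (avg_joint_continuous cw cf)).
Qed.

Lemma avg_fun_is_derive w f p (i : 'I_n) : continuous w -> is_Ck 1 f ->
  is_derive p (delta_mx ord0 i) (avg_fun w M f)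
    (\sum_j avg_fun (fun s => w s * M s i j) M (partial_fun j f) p).
Proof.
move=> cw hf; have [cf pf] := hf.
have cpf j : continuous (partial_fun j f) by have [_ []] := pf j.
have cwM j : continuous (fun s => w s * M s i j).
  by move=> s; exact: (continuousM (cw s) (@cM i j s)).
set e : 'rV[R]_n := delta_mx ord0 i.
pose dg (t s : R) := \sum_j w s * M s i j * partial_fun j f ((p + t *: e) *m M s).
have cline : continuous (fun t : R => p + t *: e).
  move=> t; apply: cvgD; first exact: cvg_cst.
  by apply: cvgZr_tmp; exact: cvg_id.
have cdg : continuous (fun ts : R * R => dg ts.1 ts.2).
  apply: continuous_big => [|j _]; first exact: add_continuous.
  move=> ts.
  apply: (@continuous_comp _ _ _ (fun ts : R * R => (p + ts.1 *: e, ts.2))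
    (fun ps : 'rV[R]_n * R => w ps.2 * M ps.2 i j * partial_fun j f (ps.1 *m M ps.2))).
    have c1 : {for ts, continuous (fun ts : R * R => p + ts.1 *: e)}.
      apply: (@continuous_comp _ _ _ fst (fun t : R => p + t *: e)).
        exact: cvg_fst.
      exact: cline.
    exact: (cvg_pair c1 (@cvg_snd _ _ _ _ _)).
  exact: (avg_joint_continuous (cwM j) (cpf j)).
have dgE (t s : R) : is_derive t 1 (fun t => w s * f ((p + t *: e) *m M s)) (dg t s).
  have H : is_derive t 1 (fun t => f ((p + t *: e) *m M s))
     (\sum_j M s i j * partial_fun j f ((p + t *: e) *m M s)).
    have E j : M s i j = ((fun=> row i (M s)) t : 'rV_n) ord0 j by rewrite mxE.
    under eq_bigr do rewrite E.
    apply: (is_derive_curve hf) => j.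
    have -> : (fun t => ((p + t *: e) *m M s) ord0 j) =
              (fun t => (p *m M s) ord0 j + t * M s i j).
      by apply/funext => u; rewrite mulmxDl -scalemxAl -rowE !mxE.
    rewrite mxE; apply: is_derive_eq; rewrite /GRing.scale /=.
    by rewrite add0r mulr0 add0r mulr1 mul1r.
  have := @is_deriveZ _ _ _ (fun t : R => f ((p + t *: e) *m M s)) (w s) t 1 _ H.
  by rewrite scaler_sumr; under eq_bigr do rewrite [_ *: _]mulrA.
have H := @integral01_is_derive _ (fun t s => w s * f ((p + t *: e) *m M s)) dg 0
  (fun t => @avg_integrand_continuous w f (p + t *: e) cw cf) cdg dgE.
have E : (fun h : R => h^-1 *: (avg_fun w M f (p + (h *: 1 + 0) *: e)
                                - avg_fun w M f (p + 0 *: e)))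
    = (fun h : R => h^-1 *: (avg_fun w M f (h *: e + p) - avg_fun w M f p)).
  apply/funext => h; rewrite addr0 scale0r addr0 [p + _]addrC.
  by rewrite [h *: 1]mulr1.
have dE : \sum_j avg_fun (fun s => w s * M s i j) M (partial_fun j f) p = integral01 (dg 0).
  rewrite /dg integral01_sum; last first.
    by move=> j; exact: avg_integrand_continuous.
  by rewrite scale0r addr0.
rewrite dE; case: H => H1 H2; apply: DeriveDef.
  by move: H1; rewrite /derivable E.
by move: H2; rewrite /derive E.
Qed.

Lemma partial_avg_fun w f p (i : 'I_n) : continuous w -> is_Ck 1 f ->
  partial_fun i (avg_fun w M f) p =
  integral01 (fun s => \sum_j w s * M s i j * partial_fun j f (p *m M s)).
Proof.
move=> cw hf; have [_ E] := avg_fun_is_derive p i cw hf; rewrite [LHS]E.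
have [cf pf] := hf.
rewrite integral01_sum // => j; apply: avg_integrand_continuous.
  by move=> s; exact: (continuousM (cw s) (@cM i j s)).
by have [_ []] := pf j.
Qed.

Lemma is_Ck_sum k (I : Type) (r : seq I) (F : I -> 'rV[R]_n -> R) :
  (forall i, is_Ck k (F i)) -> is_Ck k (fun p => \sum_(i <- r) F i p).
Proof.
move=> hF; elim: r => [|i r IH].
  under eq_fun do rewrite big_nil; exact: is_Ck_cst.
by under eq_fun do rewrite big_cons; exact: (is_Ck_add (hF i) IH).
Qed.

(** Induction on k with w generalized: each partial derivative is a sum of averages of partial
    derivatives of f with new weights. *)
Lemma avg_fun_Ck k w f : continuous w -> is_Ck k f -> is_Ck k (avg_fun w M f).
Proof.
elim: k w f => [|k IH] w f cw hf.
  by split=> //; apply: avg_fun_continuous => //; case: hf.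
have hf1 : is_Ck 1 f.
  have [cf pf] := hf; split=> // i; have [df pfi] := pf i; split=> //.
  by split=> //; case: k {IH hf pf} pfi => [|k] [].
split; first by apply: avg_fun_continuous => //; case: hf.
move=> i; split; first by move=> p; have [] := avg_fun_is_derive p i cw hf1.
have -> : partial_fun i (avg_fun w M f) =
    (fun p => \sum_j avg_fun (fun s => w s * M s i j) M (partial_fun j f) p).
  by apply/funext => p; have [] := avg_fun_is_derive p i cw hf1.
apply: is_Ck_sum => j; apply: IH.
  by move=> s; exact: (continuousM (cw s) (@cM i j s)).
by have [_ /(_ j)[]] := hf.
Qed.

Lemma avg_fun_smooth w f : continuous w -> f \in @smooth R n ->
  avg_fun w M f \in @smooth R n.
Proof. by move=> cw /smoothP hf; apply/smoothP => k; exact: avg_fun_Ck. Qed.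

(* N extends continuously W M', whose second factor may be singular at the   *)
(* end points.                                                               *)
Lemma avg_fun_FTC (W dW : R -> R) (dM N : R -> 'M[R]_n) f p :
    continuous W -> continuous dW -> mx_cont N -> is_Ck 1 f ->
    (forall s : R, 0 < s < 1 -> is_derive s 1 W (dW s)) ->
    (forall (s : R) i j, 0 < s < 1 -> is_derive s 1 (fun t => M t i j) (dM s i j)) ->
    (forall s : R, 0 < s < 1 -> N s = W s *: dM s) ->
  W 1 * f (p *m M 1) - W 0 * f (p *m M 0) =
  integral01 (fun s => dW s * f (p *m M s) +
    \sum_j (p *m N s) ord0 j * partial_fun j f (p *m M s)).
Proof.
move=> cW cdW cN hf WE ME NE; have [cf pf] := hf.
have cpf j : continuous (partial_fun j f) by have [_ []] := pf j.
symmetry; apply: (@integral01_FTC _ (fun s => W s * f (p *m M s))).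
- exact: avg_integrand_continuous.
- move=> s; apply: (@continuousD _ _ _ (fun s => dW s * f (p *m M s))).
    exact: avg_integrand_continuous.
  move: s; apply: continuous_big => [|j _]; first exact: add_continuous.
  apply: avg_integrand_continuous => // s.
  have -> : (fun s => (p *m N s) ord0 j) = (fun s => \sum_k p ord0 k * N s k j).
    by apply/funext => t; rewrite mxE.
  move: s; apply: continuous_big => [|k _]; first exact: add_continuous.
  move=> s; apply: (@continuousM _ _ (cst (p ord0 k)) (fun s => N s k j)).
    exact: cst_continuous.
  exact: cN.
move=> s s01.
have D : is_derive s 1 (fun s => f (p *m M s))
    (\sum_j (p *m dM s) ord0 j * partial_fun j f (p *m M s)).
  apply: (@is_derive_curve _ _ _ _ (fun s => p *m dM s)) => // j.
  have -> : (fun t => (p *m M t) ord0 j) = \sum_k (p ord0 k *: (fun t => M t k j)).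
    by apply/funext => t; rewrite mxE fct_sumE.
  rewrite mxE; apply: is_derive_sum => k.
  by apply: is_deriveZ; exact: ME.
have := @is_deriveM _ _ W (fun s => f (p *m M s)) s 1 _ _ (WE s s01) D.
congr (is_derive _ _ _ _); rewrite addrC; congr (_ + _); first exact: mulrC.
rewrite scaler_sumr; apply: eq_bigr => j _; rewrite NE // -scalemxAr.
by rewrite [_ *: _]mulrA [in RHS]mxE.
Qed.

End Averaging.

(** * Hadamard's lemma, antiderivatives in one coordinate, symmetry of second derivatives *)

Section CoordinateHadamard.
Local Open Scope classical_set_scope.
Variables (R : realType) (n : nat).
Implicit Types (f g : Cinf R n) (i j k : 'I_n) (p : 'rV[R]_n).

Lemma Cinf_eq f g : (forall p, f p = g p) -> f = g.
Proof. by move=> fg; apply/val_inj/funext. Qed.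

Lemma Cinf_addE f g p : (f + g) p = f p + g p. Proof. by []. Qed.
Lemma Cinf_mulE f g p : (f * g) p = f p * g p. Proof. by []. Qed.
Lemma Cinf_oppE f p : (- f) p = - f p. Proof. by []. Qed.
Lemma Cinf_zeroE p : (0 : Cinf R n) p = 0. Proof. by []. Qed.
Lemma Cinf_oneE p : (1 : Cinf R n) p = 1. Proof. by []. Qed.

Lemma Cinf_Ck (m : nat) f : is_Ck m f.
Proof. by have /smoothP := Cinf_smooth f. Qed.

Lemma Cinf_continuous f : continuous f.
Proof. by case: (Cinf_Ck 0%N f). Qed.

Lemma cst1_continuous : continuous (cst 1 : R -> R).
Proof. exact: cst_continuous. Qed.

Lemma partial_constf i (c : R) : partial i (constf n c) = 0.
Proof. by apply: Cinf_eq => p; rewrite /= /partial_fun derive_cst. Qed.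

Definition dilation i (s : R) : 'M[R]_n :=
  diag_mx (\row_j if j == i then s else 1).

Lemma mulmx_dilation i s p j :
  (p *m dilation i s) ord0 j = p ord0 j * (if j == i then s else 1).
Proof. by rewrite mul_mx_diag !mxE. Qed.

Lemma dilation1 i p : p *m dilation i 1 = p.
Proof. by apply/rowP => j; rewrite mulmx_dilation if_same mulr1. Qed.

Lemma dilationE i s k j :
  dilation i s k j = if k == j then (if j == i then s else 1) else 0.
Proof.
rewrite mxE /=; case: (k =P j) => [->|_]; rewrite ?mulr1n ?mulr0n //.
by rewrite mxE.
Qed.

Lemma dilation_cont i : mx_cont (dilation i).
Proof.
move=> k j; have -> : (fun s => dilation i s k j) =
  (fun s => if k == j then (if j == i then s else 1) else 0).
  by apply/funext => s; rewrite dilationE.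
by case: (k == j); [case: (j == i)|] => s;
  [exact: cvg_id|exact: cvg_cst|exact: cvg_cst].
Qed.

Lemma cst_mx_cont (A : 'M[R]_n) : mx_cont (fun=> A).
Proof. by move=> k j; exact: cst_continuous. Qed.

Definition coord_avg i f : Cinf R n :=
  MkCinf (avg_fun_smooth (@dilation_cont i) cst1_continuous (Cinf_smooth f)).

(** Restriction to x_i = 0, written as an average over a constant path so that its smoothness is an
    instance of [avg_fun_smooth]. *)
Definition coord_restr i f : Cinf R n :=
  MkCinf (avg_fun_smooth (@cst_mx_cont (dilation i 0)) cst1_continuous
    (Cinf_smooth f)).

Lemma integral01_cst (c : R) : integral01 (fun=> c) = c.
Proof.
rewrite /integral01 Rintegral_cst; last exact: measurable_itv.
by rewrite [X in fine X]mu01 mulr1.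
Qed.

Lemma coord_restrE i f p : coord_restr i f p = f (p *m dilation i 0).
Proof. by rewrite [LHS](integral01_cst (1 * f _)) mul1r. Qed.

Lemma coord_avgE i f p : coord_avg i f p = integral01 (fun s => f (p *m dilation i s)).
Proof. by apply: eq_integral01 => s _; rewrite mul1r. Qed.

Lemma sum_dilation i s k (F : 'I_n -> R) :
  \sum_j dilation i s k j * F j = (if k == i then s else 1) * F k.
Proof.
rewrite (bigD1 k) //= big1 => [|j jk]; rewrite dilationE ?eqxx ?addr0 //.
by rewrite eq_sym (negbTE jk) mul0r.
Qed.

Lemma partial_coord_avgE i k f p : partial k (coord_avg i f) p =
  integral01 (fun s => (if k == i then s else 1) * partial k f (p *m dilation i s)).
Proof.
rewrite [LHS](partial_avg_fun (@dilation_cont i) p k cst1_continuous (Cinf_Ck 1 f)).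
apply: eq_integral01 => s _; under eq_bigr do rewrite mul1r.
exact: sum_dilation.
Qed.

Lemma partial_coord_avg i k f : k != i -> partial k (coord_avg i f) = coord_avg i (partial k f).
Proof.
move=> ki; apply: Cinf_eq => p; rewrite partial_coord_avgE coord_avgE (negbTE ki).
by apply: eq_integral01 => s _; rewrite mul1r.
Qed.

Lemma partial_coord_restr i k f :
  partial k (coord_restr i f) = if k == i then 0 else coord_restr i (partial k f).
Proof.
apply: Cinf_eq => p.
rewrite [LHS](partial_avg_fun (@cst_mx_cont _) p k cst1_continuous (Cinf_Ck 1 f)).
rewrite [LHS](integral01_cst (\sum_j 1 * dilation i 0 k j *
  partial j f (p *m dilation i 0))).
under eq_bigr do rewrite mul1r.
rewrite sum_dilation; case: (k == i); first by rewrite mul0r.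
by rewrite mul1r coord_restrE.
Qed.

Lemma mulmx_delta i p j : (p *m delta_mx i i) ord0 j = (p ord0 i) *+ (j == i).
Proof.
rewrite mxE (bigD1 i) //= big1 => [|k ki]; rewrite mxE ?(negbTE ki) ?mulr0 //.
by rewrite eqxx addr0 mulr_natr.
Qed.

Lemma delta_mx_dilation (s : R) i k j :
  is_derive s 1 (fun t => dilation i t k j) ((delta_mx i i : 'M[R]_n) k j).
Proof.
have -> : (fun s => dilation i s k j) =
  (fun s => if k == j then (if j == i then s else 1) else 0).
  by apply/funext => t; rewrite dilationE.
rewrite mxE; case: (k =P j) => [->|kj]; last first.
  have -> : (k == i) && (j == i) = false.
    by apply/negP => /andP[/eqP ki /eqP ji]; apply: kj; rewrite ki ji.
  exact: is_derive_cst.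
by case: (j == i); [exact: is_derive_id|exact: is_derive_cst].
Qed.

Lemma continuous_dilated i f p : continuous (fun s => f (p *m dilation i s)).
Proof.
have := @avg_integrand_continuous _ _ _ (@dilation_cont i) (cst 1) f p
  cst1_continuous (@Cinf_continuous f).
by under eq_fun do rewrite mul1r.
Qed.

(** The fundamental theorem of calculus for s |-> f with x_i replaced by s x_i. *)
Lemma hadamard i f : f = coord_restr i f + coord R i * coord_avg i (partial i f).
Proof.
apply: Cinf_eq => p; rewrite Cinf_addE Cinf_mulE coord_restrE coord_avgE.
apply/eqP; rewrite addrC -subr_eq; apply/eqP.
have := @avg_fun_FTC _ _ _ (@dilation_cont i) (cst 1) (cst 0)
  (fun=> delta_mx i i) (fun=> delta_mx i i) f p cst1_continuous
  (@cst_continuous _ _ _) (@cst_mx_cont _) (Cinf_Ck 1 f)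
  (fun s _ => is_derive_cst _ _ _) (fun s k j _ => delta_mx_dilation s i k j).
rewrite /cst dilation1 !mul1r => -> => [|s _]; last by rewrite scale1r.
rewrite -integral01Z; last exact: continuous_dilated.
apply: eq_integral01 => s _; rewrite mul0r add0r (bigD1 i) //= big1 ?addr0.
  by rewrite mulmx_delta eqxx.
by move=> j ji; rewrite mulmx_delta (negbTE ji) mul0r.
Qed.

(** So x_i times the average is the antiderivative of f in x_i vanishing on x_i = 0. The proof
    integrates the derivative of s f(.., s x_i, ..) over [0, 1]. *)
Lemma partial_coord_mul_avg i f : partial i (coord R i * coord_avg i f) = f.
Proof.
rewrite partialM partial_coord eqxx mul1r.
apply: Cinf_eq => p; rewrite Cinf_addE Cinf_mulE partial_coord_avgE eqxx coord_avgE.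
have cN : mx_cont (fun s : R => s *: (delta_mx i i : 'M[R]_n)).
  move=> k j; under eq_fun do rewrite mxE.
  by move=> s; apply: cvgMr_tmp; exact: cvg_id.
have cs : continuous (fun s : R => s * partial i f (p *m dilation i s)).
  apply: avg_integrand_continuous; first exact: dilation_cont.
    by move=> s; exact: cvg_id.
  exact: Cinf_continuous.
have := @avg_fun_FTC _ _ _ (@dilation_cont i) id (cst 1)
  (fun=> delta_mx i i) (fun s => s *: delta_mx i i) f p
  (fun s => @cvg_id _ _) cst1_continuous cN (Cinf_Ck 1 f)
  (fun s _ => is_derive_id _ _) (fun s k j _ => delta_mx_dilation s i k j)
  (fun s _ => erefl).
rewrite dilation1 mul1r mul0r subr0 => ->.
rewrite -[X in X + _]integral01Z // -integral01D; last 2 first.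
- by move=> s; apply: cvgMl_tmp; exact: cs.
- exact: continuous_dilated.
apply: eq_integral01 => s _; rewrite /cst mul1r addrC (bigD1 i) //= big1 ?addr0.
  by rewrite -scalemxAr mxE mulmx_delta eqxx mulr1n mulrA [s * _]mulrC.
by move=> j ji; rewrite -scalemxAr mxE mulmx_delta (negbTE ji) mulr0 mul0r.
Qed.

(* Both mixed derivatives are read off from f = f|_{x_i = 0} + x_i g, where  *)
(* partial_coord_mul_avg differentiates the second summand in x_i.           *)
Lemma partial_comm i j f : partial i (partial j f) = partial j (partial i f).
Proof.
have [->//|ji] := eqVneq j i.
rewrite {1}(hadamard i f) partialD partialM partial_coord (negbTE ji) mul0r.
rewrite addr0 partial_coord_avg // partialD partial_coord_mul_avg partial_coord_restr.
by rewrite (negbTE ji) partial_coord_restr eqxx add0r.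
Qed.

Lemma coord_avg0 i : coord_avg i 0 = 0.
Proof.
by apply: Cinf_eq => p; rewrite coord_avgE (_ : (fun=> _) = fun=> 0) ?integral01_cst.
Qed.

Lemma coord_restr0 i : coord_restr i 0 = 0.
Proof. by apply: Cinf_eq => p; rewrite coord_restrE. Qed.

(** Off the hyperplane x_i = 0 one divides; on it, the x_i-derivative of x_i f restricts to f. *)
Lemma coord_mul_eq0 i f : coord R i * f = 0 -> f = 0.
Proof.
move=> xf0.
have r0 : coord_restr i f = 0.
  have := congr1 (coord_restr i \o partial i) xf0.
  rewrite /= partial0 coord_restr0 partialM partial_coord eqxx mul1r addrC => E.
  rewrite -E; apply: Cinf_eq => p; rewrite !coord_restrE Cinf_addE Cinf_mulE.
  by rewrite [coord R i _]mulmx_dilation eqxx mulr0 mul0r addr0.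
apply: Cinf_eq => p; have [p0|p0] := eqVneq (p ord0 i) 0.
  rewrite -r0 coord_restrE; congr (f _); apply/rowP => j; rewrite mulmx_dilation.
  by case: eqP => [->|_]; rewrite ?mulr1 // p0 mul0r.
have /eqP := congr1 (fun g : Cinf R n => g p) xf0.
by rewrite Cinf_mulE Cinf_zeroE mulf_eq0 (negbTE p0) => /eqP.
Qed.

End CoordinateHadamard.

(** * The flow of V and the inverse of 1 + V *)

Section XLnX.
Local Open Scope classical_set_scope.
Variable R : realType.

(** Apply ln v < v to v = 1 / sqrt s. For s <= 0 the convention that [ln] vanishes there makes the
    left side 0. *)
Lemma normr_xlnx_le (s : R) : s < 1 -> `|s * ln s| <= 2 * Num.sqrt s.
Proof.
move=> s1; have [s0|s0] := leP s 0.
  by rewrite ln0 // mulr0 normr0 mulr_ge0 ?sqrtr_ge0.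
set u := Num.sqrt s; have u0 : 0 < u by rewrite sqrtr_gt0.
have su : s = u ^+ 2 by rewrite sqr_sqrtr ?ltW.
have : ln u^-1 < u^-1 by apply: ln_sublinear; rewrite invr_gt0.
rewrite lnV ?posrE // => lnu.
have lns : ln s = 2 * ln u by rewrite su lnXn // mulr_natl.
rewrite ler0_norm; last by rewrite pmulr_rle0 // ltW // ln_lt0 // s0 s1.
rewrite lns su.
have : - ln u * u < 1 by rewrite -ltr_pdivlMr // div1r.
by move=> H; nra.
Qed.

Lemma continuous_xlnx : continuous (fun s : R => s * ln s).
Proof.
move=> t; have [t0|t0|->] := ltgtP t 0.
- have E : {near t, (cst 0 : R -> R) =1 (fun s => s * ln s)}.
    by near=> s; rewrite ln0 ?mulr0 // ltW //; near: s; exact: lt_nbhsl.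
  apply: (cvg_trans (near_eq_cvg E)); rewrite ln0 ?mulr0 ?(ltW t0) //.
  exact: cvg_cst.
- by apply: cvgM; [exact: cvg_id|exact: continuous_ln].
rewrite /continuous_at mul0r; apply: norm_cvg0.
apply: (@squeeze_cvgr _ _ _ _ (cst 0) (fun s => 2 * Num.sqrt s)).
- near=> s; rewrite normr_ge0 normr_xlnx_le //.
  by near: s; apply: lt_nbhsl; exact: ltr01.
- exact: cvg_cst.
- have H := @sqrt_continuous R 0; rewrite /continuous_at sqrtr0 in H.
  by rewrite -[X in _ --> X](mulr0 (2 : R)); exact: cvgMl_tmp.
Unshelve. all: by end_near.
Qed.

End XLnX.

Lemma sum_ord3 (V : nmodType) (F : 'I_3 -> V) : \sum_i F i = F i0 + F i1 + F i2.
Proof.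
rewrite !big_ord_recl big_ord0 addr0 addrA.
by congr (F _ + F _ + F _); apply/val_inj.
Qed.

Section Resolvent.
Local Open Scope classical_set_scope.
Variable R : realType.
Implicit Types (f g : Cinf R 3) (p : 'rV[R]_3) (s : R).

(* The matrix of (x, y, z) |-> (a x, b y + c x, d z) acting on row vectors. *)
Definition trig_mx (a b c d : R) : 'M[R]_3 :=
  \matrix_(i, j) nth 0 (nth [::] [:: [:: a; c; 0]; [:: 0; b; 0]; [:: 0; 0; d]] i) j.

Lemma mulmx_trig a b c d p :
  [/\ (p *m trig_mx a b c d) ord0 i0 = p ord0 i0 * a,
      (p *m trig_mx a b c d) ord0 i1 = p ord0 i0 * c + p ord0 i1 * b
    & (p *m trig_mx a b c d) ord0 i2 = p ord0 i2 * d].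
Proof.
by split; rewrite mxE sum_ord3 !mxE /= ?mulr0 ?addr0 ?add0r.
Qed.

Lemma ord3P (P : 'I_3 -> Prop) : P i0 -> P i1 -> P i2 -> forall i, P i.
Proof.
move=> P0 P1 P2; case=> [[|[|[|//]]] lti]; [move: P0|move: P1|move: P2];
  by congr P; exact/val_inj.
Qed.

(* The flow of x d_x + (x + y) d_y at time ln s. *)
Definition flow_mx s : 'M[R]_3 := trig_mx s s (s * ln s) 1.

Lemma trig_mx_cont (a b c d : R -> R) : continuous a -> continuous b ->
  continuous c -> continuous d -> mx_cont (fun s => trig_mx (a s) (b s) (c s) (d s)).
Proof.
move=> ca cb cc cd; have c0 : continuous (fun _ : R => 0 : R) by move=> s; exact: cvg_cst.
move=> i j.
rewrite (_ : (fun s => _) = fun s => nth 0 (nth [::] [:: [:: a s; c s; 0];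
  [:: 0; b s; 0]; [:: 0; 0; d s]] i) j); last by apply/funext => s; rewrite mxE.
by elim/ord3P: i; elim/ord3P: j.
Qed.

Lemma id_continuous : continuous (id : R -> R).
Proof. by move=> s; exact: cvg_id. Qed.

Lemma flow_mx_cont : mx_cont flow_mx.
Proof.
apply: trig_mx_cont; [exact: id_continuous|exact: id_continuous| |].
  exact: continuous_xlnx.
exact: cst_continuous.
Qed.

Definition planar_lie f : Cinf R 3 :=
  cx R * partial i0 f + (cx R + cy R) * partial i1 f.

(* Averaging over the flow of V = planar_lie: \int_(-oo)^0 e^t f(phi_t) dt,  *)
(* with s = e^t, is the inverse of 1 + V.                                    *)
Definition resolvent f : Cinf R 3 :=
  MkCinf (avg_fun_smooth flow_mx_cont (@cst1_continuous R) (Cinf_smooth f)).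

Lemma resolventE f p : resolvent f p = integral01 (fun s => f (p *m flow_mx s)).
Proof. by apply: eq_integral01 => s _; rewrite mul1r. Qed.

Lemma planar_lieE f p : planar_lie f p =
  p ord0 i0 * partial i0 f p + (p ord0 i0 + p ord0 i1) * partial i1 f p.
Proof. by []. Qed.

Lemma continuous_flow f p : continuous (fun s => f (p *m flow_mx s)).
Proof.
have := @avg_integrand_continuous _ _ _ flow_mx_cont (cst 1) f p
  (@cst1_continuous R) (@Cinf_continuous _ _ f).
by under eq_fun do rewrite mul1r.
Qed.

(** With phi the flow at time ln s, s |-> s (f o phi) has derivative (f + V f) o phi. It equals f at
    s = 1, and the factor s makes it vanish at s = 0. *)
Lemma resolventK f : resolvent (f + planar_lie f) = f.
Proof.
apply: Cinf_eq => p; rewrite resolventE.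
(* The derivative of [flow_mx] is unbounded at s = 0, but s times it extends continuously as N. *)
pose dM s := trig_mx 1 1 (ln s + 1) 0.
pose N s := trig_mx s s (s * ln s + s) 0.
have cN : mx_cont N.
  apply: trig_mx_cont; [exact: id_continuous|exact: id_continuous| |].
    by move=> s; apply: cvgD; [exact: continuous_xlnx|exact: cvg_id].
  exact: cst_continuous.
have ME s i j : 0 < s < 1 -> is_derive s 1 (fun t => flow_mx t i j) (dM s i j).
  move=> /andP[s0 _]; rewrite mxE.
  rewrite (_ : (fun t => _) = fun t => nth 0 (nth [::] [:: [:: t; t * ln t; 0];
    [:: 0; t; 0]; [:: 0; 0; 1]] i) j); last by apply/funext => t; rewrite mxE.
  elim/ord3P: i; elim/ord3P: j => /=.
  all: try (exact: is_derive_id || exact: is_derive_cst).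
  have D := is_derive1_ln s0; apply: is_derive_eq; rewrite /GRing.scale /=.
  by rewrite mulfV ?gt_eqF // mulr1 addrC.
have NE s : 0 < s < 1 -> N s = id s *: dM s.
  move=> _; apply/matrixP => i j; rewrite !mxE.
  by elim/ord3P: i; elim/ord3P: j => /=; rewrite ?mulr0 ?mulr1 ?mulrDr ?mulr1.
have := @avg_fun_FTC _ _ _ flow_mx_cont id (cst 1) dM N f p id_continuous
  (@cst1_continuous R) cN (Cinf_Ck 1 f) (fun s _ => is_derive_id _ _) ME NE.
have -> : p *m flow_mx 1 = p.
  have [E0 E1 E2] := mulmx_trig 1 1 (1 * ln 1) 1 p.
  by apply/rowP; elim/ord3P; rewrite ?E0 ?E1 ?E2 ?ln1 ?mulr0 ?mulr1 ?add0r.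
rewrite mul1r mul0r subr0 => ->; apply: eq_integral01 => s _.
rewrite /cst mul1r Cinf_addE planar_lieE; congr (_ + _).
have [E0 E1 _] := mulmx_trig s s (s * ln s) 1 p; rewrite -/(flow_mx s) in E0 E1.
have [F0 F1 F2] := mulmx_trig s s (s * ln s + s) 0 p; rewrite -/(N s) in F0 F1 F2.
rewrite sum_ord3 F0 F1 F2 E0 E1 mulr0 mul0r addr0.
by rewrite mulrDr addrA [p ord0 i0 * s + _ in LHS]addrC.
Qed.

Lemma partial_resolventE i f p : partial i (resolvent f) p =
  integral01 (fun s => \sum_j flow_mx s i j * partial j f (p *m flow_mx s)).
Proof.
rewrite [LHS](partial_avg_fun flow_mx_cont p i (@cst1_continuous R) (Cinf_Ck 1 f)).
by apply: eq_integral01 => s _; under eq_bigr do rewrite mul1r.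
Qed.

(** V is invariant under its own flow, so it commutes with averaging over the flow. *)
Lemma planar_lie_resolvent f :
  planar_lie (resolvent f) = resolvent (planar_lie f).
Proof.
apply: Cinf_eq => p; rewrite planar_lieE !partial_resolventE resolventE.
have cs i : continuous (fun s => \sum_j flow_mx s i j * partial j f (p *m flow_mx s)).
  apply: continuous_big => [|j _]; first exact: add_continuous.
  apply: avg_integrand_continuous; first exact: flow_mx_cont.
    exact: flow_mx_cont.
  exact: Cinf_continuous.
rewrite -!integral01Z // -integral01D; last 2 first.
- by move=> s; apply: cvgMl_tmp; exact: cs.
- by move=> s; apply: cvgMl_tmp; exact: cs.
apply: eq_integral01 => s _; rewrite planar_lieE.
have [-> -> _] := mulmx_trig s s (s * ln s) 1 p; rewrite -/(flow_mx s).
rewrite !sum_ord3 !mxE /=.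
move: (partial_fun i0 f _) (partial_fun i1 f _) (partial_fun i2 f _) => f0 f1 f2.
ring.
Qed.

Lemma planar_lieD f g : planar_lie (f + g) = planar_lie f + planar_lie g.
Proof. rewrite /planar_lie !partialD; ring. Qed.

Lemma resolventD f g : resolvent (f + g) = resolvent f + resolvent g.
Proof.
apply: Cinf_eq => p; rewrite Cinf_addE !resolventE -integral01D //;
  exact: continuous_flow.
Qed.

Lemma planar_lie_resolventD f : planar_lie (resolvent f) + resolvent f = f.
Proof. by rewrite planar_lie_resolvent -resolventD addrC resolventK. Qed.

Lemma resolvent0 : resolvent 0 = 0.
Proof.
by apply: Cinf_eq => p; rewrite resolventE (_ : (fun=> _) = fun=> 0) ?integral01_cst.
Qed.

Lemma partial2_resolvent f : partial i2 (resolvent f) = resolvent (partial i2 f).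
Proof.
apply: Cinf_eq => p; rewrite partial_resolventE resolventE.
apply: eq_integral01 => s _; rewrite sum_ord3 !mxE /=.
by rewrite !mul0r !add0r mul1r.
Qed.

End Resolvent.

(* Otherwise comparing two distinct derivatives unfolds them down to limits. *)
#[local] Opaque partial.

(** * Components of multivector fields on R^3 *)

Section Subsets3.

(** Subsets of the three indices as triples of booleans: identities of multivector fields become
    eight computations by case analysis. *)
Definition bset (b0 b1 b2 : bool) : {set 'I_3} :=
  [set i : 'I_3 | nth false [:: b0; b1; b2] i].

Lemma in_bset b0 b1 b2 (i : 'I_3) :
  (i \in bset b0 b1 b2) = nth false [:: b0; b1; b2] i.
Proof. by rewrite inE. Qed.

Lemma bset_mem (K : {set 'I_3}) : bset (i0 \in K) (i1 \in K) (i2 \in K) = K.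
Proof. by apply/setP; elim/ord3P; rewrite in_bset. Qed.

Lemma bset_ind (P : {set 'I_3} -> Prop) :
  (forall b0 b1 b2, P (bset b0 b1 b2)) -> forall K, P K.
Proof. by move=> Pb K; rewrite -(bset_mem K). Qed.

Lemma bsetD b0 b1 b2 c0 c1 c2 : bset b0 b1 b2 :\: bset c0 c1 c2 =
  bset (b0 && ~~ c0) (b1 && ~~ c1) (b2 && ~~ c2).
Proof. by apply/setP; elim/ord3P; rewrite inE !in_bset andbC. Qed.

Lemma bset_subset b0 b1 b2 c0 c1 c2 : (bset b0 b1 b2 \subset bset c0 c1 c2) =
  [&& b0 ==> c0, b1 ==> c1 & b2 ==> c2].
Proof.
apply/fintype.subsetP/and3P => [sbc|[h0 h1 h2]].
  by split; [move: (sbc i0)|move: (sbc i1)|move: (sbc i2)];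
    rewrite !in_bset /= => /implyP.
by elim/ord3P; rewrite !in_bset /=; apply/implyP.
Qed.

Lemma sum_bset (V : nmodType) (P : pred {set 'I_3}) (F : {set 'I_3} -> V) :
  \sum_(I | P I) F I =
  \sum_b0 \sum_b1 \sum_b2 if P (bset b0 b1 b2) then F (bset b0 b1 b2) else 0.
Proof.
rewrite (reindex (fun b : bool * bool * bool => bset b.1.1 b.1.2 b.2)) /=; last first.
  exists (fun K : {set 'I_3} => (i0 \in K, i1 \in K, i2 \in K)).
    by move=> [[b0 b1] b2] _; rewrite !in_bset.
  by move=> K _; rewrite bset_mem.
rewrite big_mkcond /= pair_bigA pair_bigA /=.
by apply: eq_bigr => -[[b0 b1] b2].
Qed.

Lemma inversions_bset b0 b1 b2 c0 c1 c2 :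
  inversions (bset b0 b1 b2) (bset c0 c1 c2) = (b1 && c0 + b2 && c0 + b2 && c1)%N.
Proof.
rewrite /inversions big_mkcond sum_ord3 !in_bset /=.
rewrite ![\sum_(j in bset c0 c1 c2) _]big_mkcond !sum_ord3 !in_bset /=.
by case: b0 b1 b2 c0 c1 c2 => [] [] [] [] [] [].
Qed.

Lemma card_bset b0 b1 b2 : #|bset b0 b1 b2| = (b0 + b1 + b2)%N.
Proof. by rewrite -sum1_card big_mkcond sum_ord3 !in_bset; case: b0 b1 b2 => [] [] []. Qed.

Lemma set1_bset (i : 'I_3) : [set i] = bset (i == i0) (i == i1) (i == i2).
Proof. by rewrite -[LHS]bset_mem !inE ![_ == i]eq_sym. Qed.

Lemma bset_eq b0 b1 b2 c0 c1 c2 : (bset b0 b1 b2 == bset c0 c1 c2) =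
  [&& b0 == c0, b1 == c1 & b2 == c2].
Proof.
apply/eqP/and3P => [bc|[/eqP-> /eqP-> /eqP->] //].
by split; apply/eqP; [have := congr1 (fun K : {set 'I_3} => i0 \in K) bc
  |have := congr1 (fun K : {set 'I_3} => i1 \in K) bc
  |have := congr1 (fun K : {set 'I_3} => i2 \in K) bc]; rewrite !in_bset.
Qed.

Lemma bsetU b0 b1 b2 c0 c1 c2 : bset b0 b1 b2 :|: bset c0 c1 c2 =
  bset (b0 || c0) (b1 || c1) (b2 || c2).
Proof. by rewrite -[LHS]bset_mem !inE. Qed.

End Subsets3.

Section Components.
Variable R : realType.
Local Notation A := (Cinf R 3).
Local Notation MV := (multivector R 3).
Implicit Types (P Q : MV).

Definition mvec (F : bool -> bool -> bool -> A) : MV :=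
  [ffun K : {set 'I_3} => F (i0 \in K) (i1 \in K) (i2 \in K)].

Lemma mvecE F b0 b1 b2 : mvec F (bset b0 b1 b2) = F b0 b1 b2.
Proof. by rewrite ffunE !in_bset. Qed.

Lemma mv_eq P Q : (forall b0 b1 b2, P (bset b0 b1 b2) = Q (bset b0 b1 b2)) -> P = Q.
Proof. by move=> PQ; apply/ffunP; elim/bset_ind. Qed.

Lemma wedge_bset P Q b0 b1 b2 : wedge P Q (bset b0 b1 b2) =
  \sum_c0 \sum_c1 \sum_c2 if [&& c0 ==> b0, c1 ==> b1 & c2 ==> b2] then
    (-1) ^+ (c1 && (b0 && ~~ c0) + c2 && (b0 && ~~ c0) + c2 && (b1 && ~~ c1))%N *
      (P (bset c0 c1 c2) * Q (bset (b0 && ~~ c0) (b1 && ~~ c1) (b2 && ~~ c2)))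
  else 0.
Proof.
rewrite ffunE sum_bset; do 3 (apply: eq_bigr => ? _).
by rewrite bset_subset bsetD inversions_bset.
Qed.

Lemma rcontr_bset i P b0 b1 b2 : rcontr i P (bset b0 b1 b2) =
  if nth false [:: b0; b1; b2] i then 0 else
  (-1) ^+ (b1 && (i == i0) + b2 && (i == i0) + b2 && (i == i1))%N *
    P (bset ((i == i0) || b0) ((i == i1) || b1) ((i == i2) || b2)).
Proof. by rewrite ffunE in_bset set1_bset inversions_bset bsetU. Qed.

Lemma lcontr_bset i P b0 b1 b2 : lcontr i P (bset b0 b1 b2) =
  if nth false [:: b0; b1; b2] i then 0 else
  (-1) ^+ ((i == i1) && b0 + (i == i2) && b0 + (i == i2) && b1)%N *
    P (bset ((i == i0) || b0) ((i == i1) || b1) ((i == i2) || b2)).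
Proof. by rewrite ffunE in_bset set1_bset inversions_bset bsetU. Qed.

Lemma pi3_bset b0 b1 b2 : pi3_bivector R (bset b0 b1 b2) =
  if b2 then if b0 then if b1 then 0 else cx R else if b1 then cx R + cy R else 0
  else 0.
Proof.
rewrite /pi3_bivector wedge_bset /Euler /dx /dy /dz /pd !big_bool /=.
rewrite !(mv_scaleE, ffunE) !set1_bset !bset_eq /=.
by case: b0 b1 b2 => [] [] []; rewrite /= ?(expr0, expr1) ?addr0 ?add0r; ring.
Qed.

Lemma mv_addE P Q K : (P + Q) K = P K + Q K. Proof. exact: ffunE. Qed.
Lemma mv_oppE P K : (- P) K = - P K. Proof. exact: ffunE. Qed.
Lemma mv_zeroE K : (0 : MV) K = 0. Proof. exact: ffunE. Qed.
Lemma partial_mvE i P K : partial_mv i P K = partial i (P K).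
Proof. exact: ffunE. Qed.

Lemma schouten_bset P Q b0 b1 b2 : schouten P Q (bset b0 b1 b2) =
  (wedge (rcontr i0 P) (partial_mv i0 Q) (bset b0 b1 b2) -
   wedge (partial_mv i0 P) (lcontr i0 Q) (bset b0 b1 b2)) +
  (wedge (rcontr i1 P) (partial_mv i1 Q) (bset b0 b1 b2) -
   wedge (partial_mv i1 P) (lcontr i1 Q) (bset b0 b1 b2)) +
  (wedge (rcontr i2 P) (partial_mv i2 Q) (bset b0 b1 b2) -
   wedge (partial_mv i2 P) (lcontr i2 Q) (bset b0 b1 b2)).
Proof. by rewrite /schouten sum_ord3 !(mv_addE, mv_oppE). Qed.

Lemma dpi3_bset Q b0 b1 b2 : dpi (pi3 R) Q (bset b0 b1 b2) =
  let q c0 c1 c2 := Q (bset c0 c1 c2) in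
  let x := cx R in let u := cx R + cy R in
  let V := @planar_lie R in let Dz := partial i2 in
  match b0, b1, b2 with
  | false, false, false => 0
  | true, false, false => x * Dz (q false false false)
  | false, true, false => u * Dz (q false false false)
  | false, false, true => - V (q false false false)
  | true, true, false => x * Dz (q false true false) - u * Dz (q true false false)
  | true, false, true => V (q true false false) - q true false false
                         + x * Dz (q false false true)
  | false, true, true => V (q false true false) - q true false false
                         - q false true false + u * Dz (q false false true)
  | true, true, true => x * Dz (q false true true) - u * Dz (q true false true)
                        - V (q true true false) + 2%:R * q true true false
  end.
Proof.
rewrite /dpi schouten_bset !wedge_bset !big_bool.
case: b0 b1 b2 => [] [] [] /=.
all: rewrite ?rcontr_bset ?lcontr_bset ?partial_mvE ?pi3_bset /=.
all: rewrite ?(partial0, partialD, partialM, partial_coord) /=.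
all: rewrite ?expr0 ?expr1 ?expr2.
all: rewrite /planar_lie; try ring.
Qed.

Lemma homog_bset k P (b0 b1 b2 : bool) : homog k P -> (b0 + b1 + b2)%N != k ->
  P (bset b0 b1 b2) = 0.
Proof. by move=> hP bk; apply: hP; rewrite card_bset. Qed.

Definition derivation P (f : A) : A :=
  P (bset true false false) * partial i0 f + P (bset false true false) * partial i1 f
  + P (bset false false true) * partial i2 f.

(* The right-hand side is the Lie derivative of Q along P. *)
Lemma schouten1_bset P Q b0 b1 b2 : homog 1 P ->
  schouten P Q (bset b0 b1 b2) =
  let a := P (bset true false false) in
  let b := P (bset false true false) in
  let c := P (bset false false true) in
  let q c0 c1 c2 := Q (bset c0 c1 c2) in
  let D i := partial i in
  derivation P (q b0 b1 b2) -
  match b0, b1, b2 with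
  | false, false, false => 0
  | true, false, false => q true false false * D i0 a + q false true false * D i1 a
                          + q false false true * D i2 a
  | false, true, false => q true false false * D i0 b + q false true false * D i1 b
                          + q false false true * D i2 b
  | false, false, true => q true false false * D i0 c + q false true false * D i1 c
                          + q false false true * D i2 c
  | true, true, false => q true true false * (D i0 a + D i1 b)
                         + q true false true * D i2 b - q false true true * D i2 a
  | true, false, true => q true false true * (D i0 a + D i2 c)
                         + q true true false * D i1 c + q false true true * D i1 a
  | false, true, true => q false true true * (D i1 b + D i2 c)
                         - q true true false * D i0 c + q true false true * D i0 b
  | true, true, true => q true true true * (D i0 a + D i1 b + D i2 c)
  end.
Proof.
move=> hP; rewrite /derivation.
have P0 := homog_bset hP (isT : (false + false + false)%N != 1%N).
have P110 := homog_bset hP (isT : (true + true + false)%N != 1%N).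
have P101 := homog_bset hP (isT : (true + false + true)%N != 1%N).
have P011 := homog_bset hP (isT : (false + true + true)%N != 1%N).
have P111 := homog_bset hP (isT : (true + true + true)%N != 1%N).
rewrite schouten_bset !wedge_bset !big_bool.
case: b0 b1 b2 => [] [] [] /=.
all: rewrite ?rcontr_bset ?lcontr_bset ?partial_mvE /=.
all: rewrite ?(P0, P110, P101, P011, P111) ?partial0.
all: rewrite ?expr0 ?expr1 ?expr2 /=.
all: try ring.
Qed.

End Components.

(* Abstracting the operators keeps the unifier from unfolding them when it    *)
(* compares atoms.                                                            *)
Ltac mv_atoms P :=
  move: (P (bset true true false)) (P (bset true false true))
    (P (bset false true true)) (P (bset true false false)) (P (bset false true false))
    (P (bset false false true)) (P (bset false false false))
    (P (bset true true true));
  do 8 (let q := fresh "q" in move=> q).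

(** Expands derivatives of sums and products, sorts the indices of mixed second derivatives by
    [partial_comm] with the partial derivatives as an abstract operator, and leaves a ring
    identity. *)
Ltac cinf_ring R :=
  do 3 rewrite ?partialD ?partialN ?partialM;
  rewrite ?partial_coord ?partial0 ?partial_nat /=;
  let D := fresh "D" in let DC := fresh "DC" in
  let x := fresh "x" in let y := fresh "y" in
  have := @partial_comm R 3;
  move: (@partial R 3) (coord R i0) (coord R i1) => D x y DC;
  rewrite ?(DC i1 i0, DC i2 i0, DC i2 i1); ring.

(** * Degrees, graded symmetry and Jacobi identities, in components *)

Section BracketIdentities.
Variable R : realType.
Local Notation A := (Cinf R 3).
Local Notation MV := (multivector R 3).
Implicit Types (P Q X : MV) (f : A).

Lemma rcontr_homog k i P : homog k P -> homog k.-1 (rcontr i P).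
Proof.
move=> hP K nK; rewrite ffunE; case: ifPn => // iK.
rewrite hP ?mulr0 // cardsU1 iK add1n; apply: contra nK => /eqP <-.
by rewrite eqxx.
Qed.

Lemma lcontr_homog k i P : homog k P -> homog k.-1 (lcontr i P).
Proof.
move=> hP K nK; rewrite ffunE; case: ifPn => // iK.
rewrite hP ?mulr0 // cardsU1 iK add1n; apply: contra nK => /eqP <-.
by rewrite eqxx.
Qed.

Lemma rcontr_homog0 i P : homog 0 P -> rcontr i P = 0.
Proof.
move=> hP; apply/ffunP => K; rewrite !ffunE; case: ifPn => // iK.
by rewrite hP ?mulr0 // cardsU1 iK.
Qed.

Lemma lcontr_homog0 i P : homog 0 P -> lcontr i P = 0.
Proof.
move=> hP; apply/ffunP => K; rewrite !ffunE; case: ifPn => // iK.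
by rewrite hP ?mulr0 // cardsU1 iK.
Qed.

Lemma partial_mv_homog k i P : homog k P -> homog k (partial_mv i P).
Proof. by move=> hP K nK; rewrite ffunE hP // partial0. Qed.

Lemma homog_sum k (F : 'I_3 -> MV) : (forall i, homog k (F i)) -> homog k (\sum_i F i).
Proof. by move=> hF; rewrite sum_ord3; exact: (homogD (homogD (hF i0) (hF i1)) (hF i2)). Qed.

Lemma homog_schouten p q P Q :
  homog p P -> homog q Q -> homog (p + q).-1 (schouten P Q).
Proof.
move=> hP hQ; apply: homog_sum => i; apply: homogD; last apply: homogN.
- case: p hP => [|p] hP; first by rewrite rcontr_homog0 // wedge0l; exact: homog0.
  by apply: homog_wedge; [exact: (rcontr_homog i hP)|exact: partial_mv_homog].
- case: q hQ => [|q] hQ; first by rewrite lcontr_homog0 // wedge0r; exact: homog0.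
  by rewrite addnS; apply: homog_wedge;
    [exact: partial_mv_homog|exact: (lcontr_homog i hQ)].
Qed.

Lemma homog_dpi k P : homog k P -> homog k.+1 (dpi (pi3 R) P).
Proof. exact: (homog_schouten (poisson_homog (pi3 R))). Qed.

Lemma homog_gt3 k P : (3 < k)%N -> homog k P -> P = 0.
Proof.
move=> k3 hP; apply: mv_eq => b0 b1 b2; rewrite mv_zeroE (homog_bset hP) //.
by rewrite neq_ltn (leq_ltn_trans _ k3) //; case: b0 b1 b2 => [] [] [].
Qed.

Lemma homog_eq k P Q : homog k P -> homog k Q ->
  (forall b0 b1 b2 : bool, (b0 + b1 + b2)%N = k -> P (bset b0 b1 b2) = Q (bset b0 b1 b2)) ->
  P = Q.
Proof.
move=> hP hQ PQ; apply: mv_eq => b0 b1 b2.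
have [/PQ//|nk] := eqVneq (b0 + b1 + b2)%N k.
by rewrite (homog_bset hP) // (homog_bset hQ).
Qed.

(** Checked on the component formula, where it reduces to the symmetry of second derivatives. *)
Lemma dpi3_dpi3 P : dpi (pi3 R) (dpi (pi3 R) P) = 0.
Proof.
apply: mv_eq => b0 b1 b2; rewrite mv_zeroE dpi3_bset.
case: b0 b1 b2 => [] [] [] //=; rewrite !dpi3_bset /planar_lie /cx /cy;
  mv_atoms P; cinf_ring R.
Qed.

Lemma wedge1_anticomm P Q : homog 1 P -> homog 1 Q -> wedge Q P = - wedge P Q.
Proof.
move=> hP hQ; apply: (homog_eq (homog_wedge hQ hP) (homogN (homog_wedge hP hQ))).
move=> b0 b1 b2 b; rewrite mv_oppE !wedge_bset !big_bool.
have P0 := homog_bset hP (isT : (false + false + false)%N != 1%N).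
have Q0 := homog_bset hQ (isT : (false + false + false)%N != 1%N).
by case: b0 b1 b2 b => [] [] [] // _ /=; rewrite ?P0 ?Q0 ?expr0 ?expr1 /=; ring.
Qed.

Lemma schouten21 P X : homog 2 P -> homog 1 X -> schouten P X = - schouten X P.
Proof.
move=> hP hX.
apply: (homog_eq (homog_schouten hP hX) (homogN (homog_schouten hX hP))).
move=> b0 b1 b2 b; rewrite mv_oppE (schouten1_bset _ _ _ _ hX) /derivation.
rewrite schouten_bset !wedge_bset !big_bool.
have P000 := homog_bset hP (isT : (false + false + false)%N != 2%N).
have P100 := homog_bset hP (isT : (true + false + false)%N != 2%N).
have P010 := homog_bset hP (isT : (false + true + false)%N != 2%N).
have P001 := homog_bset hP (isT : (false + false + true)%N != 2%N).
have P111 := homog_bset hP (isT : (true + true + true)%N != 2%N).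
have X000 := homog_bset hX (isT : (false + false + false)%N != 1%N).
have X110 := homog_bset hX (isT : (true + true + false)%N != 1%N).
have X101 := homog_bset hX (isT : (true + false + true)%N != 1%N).
have X011 := homog_bset hX (isT : (false + true + true)%N != 1%N).
by case: b0 b1 b2 b => [] [] [] // _ /=;
  rewrite ?rcontr_bset ?lcontr_bset ?partial_mvE /=;
  rewrite ?(P000, P100, P010, P001, P111, X000, X110, X101, X011) ?partial0;
  rewrite ?expr0 ?expr1 ?expr2 /=; ring.
Qed.

Lemma schouten0l Q : schouten 0 Q = 0.
Proof.
rewrite /schouten big1 // => i _.
have -> : rcontr i (0 : MV) = 0.
  by apply/ffunP => K; rewrite !ffunE; case: ifP => //; rewrite mulr0.
have -> : partial_mv i (0 : MV) = 0 by apply/ffunP => K; rewrite !ffunE partial0.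
by rewrite !wedge0l subr0.
Qed.

Lemma homog_fun f : homog 0 (fun_mv f).
Proof.
by apply: homogZ; have := @homog_basis R 3 finset.set0; rewrite cards0.
Qed.

Lemma fun_mv_bset0 f : fun_mv f (bset false false false) = f.
Proof.
have -> : bset false false false = finset.set0.
  by apply/finset.setP; elim/ord3P; rewrite in_bset inE.
by rewrite mv_scaleE basis_mvE eqxx mulr1.
Qed.

(** An instance of the Jacobi identity for X, pi and f. It is verified for every vector field X with
    the correction term containing d X, which then vanishes. *)
Lemma schouten_dpi_fun X f : homog 1 X -> dpi (pi3 R) X = 0 ->
  schouten X (dpi (pi3 R) (fun_mv f)) = dpi (pi3 R) (schouten X (fun_mv f)).
Proof.
move=> hX dX.
suff : schouten X (dpi (pi3 R) (fun_mv f)) =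
    dpi (pi3 R) (schouten X (fun_mv f)) - schouten (dpi (pi3 R) X) (fun_mv f).
  by rewrite dX schouten0l subr0.
have hf := homog_fun f.
have hdX := homog_dpi hX.
apply: (@homog_eq 1).
- exact: (homog_schouten hX (homog_dpi hf)).
- apply: homogD; last apply: homogN.
    by apply: homog_dpi; exact: (homog_schouten hX hf).
  exact: (homog_schouten hdX hf).
(* From here d and the bracket with X are variables, known only through their component formulas. *)
move=> b0 b1 b2 b; rewrite mv_addE mv_oppE; clear hdX dX.
have dE := @dpi3_bset R; move: (dpi (pi3 R)) dE => d dE.
have LE Q c0 c1 c2 := schouten1_bset Q c0 c1 c2 hX.
move: (schouten X) LE => L LE.
rewrite schouten_fun sum_ord3 !mv_addE !mv_scaleE !rcontr_bset.
rewrite dE !LE /derivation.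
have f000 := fun_mv_bset0 f.
have f100 := homog_bset hf (isT : (true + false + false)%N != 0%N).
have f010 := homog_bset hf (isT : (false + true + false)%N != 0%N).
have f001 := homog_bset hf (isT : (false + false + true)%N != 0%N).
case: b0 b1 b2 b => [] [] [] // _ /=; rewrite ?dE /= ?LE /planar_lie /cx /cy /derivation /=;
  rewrite ?(f000, f100, f010, f001);
  rewrite ?expr0 ?expr1 ?expr2 /=;
  mv_atoms X; cinf_ring R.
Qed.

Lemma schouten_dpi_vect X Y : homog 1 X -> homog 1 Y -> dpi (pi3 R) X = 0 ->
  schouten X (dpi (pi3 R) Y) = dpi (pi3 R) (schouten X Y).
Proof.
move=> hX hY dX.
have hdX := homog_dpi hX.
suff : schouten X (dpi (pi3 R) Y) =
    dpi (pi3 R) (schouten X Y) + schouten Y (dpi (pi3 R) X).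
  by rewrite dX schouten0 addr0.
apply: (@homog_eq 2).
- exact: (homog_schouten hX (homog_dpi hY)).
- apply: homogD.
    by apply: homog_dpi; exact: (homog_schouten hX hY).
  exact: (homog_schouten hY hdX).
move=> b0 b1 b2 b; rewrite mv_addE; clear hdX dX.
have dE := @dpi3_bset R; move: (dpi (pi3 R)) dE => d dE.
have LE Q c0 c1 c2 := schouten1_bset Q c0 c1 c2 hX.
move: (schouten X) LE => L LE.
have ME Q c0 c1 c2 := schouten1_bset Q c0 c1 c2 hY.
move: (schouten Y) ME => M ME.
rewrite dE !LE ME /derivation.
have X000 := homog_bset hX (isT : (false + false + false)%N != 1%N).
have Y000 := homog_bset hY (isT : (false + false + false)%N != 1%N).
case: b0 b1 b2 b => [] [] [] // _ /=; rewrite !dE /= ?LE /planar_lie /cx /cy /derivation /= ?(X000, Y000);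
  rewrite ?expr0 ?expr1 ?expr2 /=;
  mv_atoms X; mv_atoms Y; cinf_ring R.
Qed.

End BracketIdentities.

(** * Equations for the planar field V *)

Section PlanarEquations.
Variable R : realType.
Local Notation A := (Cinf R 3).
Implicit Types (f g h a b c p q r w : A) (k : R).

Local Notation x := (cx R).
Local Notation y := (cy R).
Local Notation z := (coord R i2).
Local Notation V := (@planar_lie R).
Local Notation D0 := (partial i0).
Local Notation D1 := (partial i1).
Local Notation D2 := (partial i2).
Local Notation cst3 := (@constf R 3).

Lemma partial_x : (D0 x = 1) * (D1 x = 0) * (D2 x = 0).
Proof. by rewrite /cx !partial_coord. Qed.

Lemma partial_y : (D0 y = 0) * (D1 y = 1) * (D2 y = 0).
Proof. by rewrite /cy !partial_coord. Qed.

Lemma partial_z : (D0 z = 0) * (D1 z = 0) * (D2 z = 1).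
Proof. by rewrite !partial_coord. Qed.

Lemma planar_lieM f g : V (f * g) = f * V g + V f * g.
Proof. rewrite /planar_lie !partialM; ring. Qed.

Lemma planar_lieN f : V (- f) = - V f.
Proof. rewrite /planar_lie !partialN; ring. Qed.

Lemma planar_lie_constf k : V (cst3 k) = 0.
Proof. by rewrite /planar_lie !partial_constf !mulr0 addr0. Qed.

Lemma planar_lie0 : V 0 = 0.
Proof. by rewrite /planar_lie !partial0 !mulr0 addr0. Qed.

Lemma planar_lie_x : V x = x.
Proof. by rewrite /planar_lie !partial_x mulr1 mulr0 addr0. Qed.

Lemma planar_lie_y : V y = x + y.
Proof. by rewrite /planar_lie !partial_y mulr1 mulr0 add0r. Qed.

Lemma planar_lie_z : V z = 0.
Proof. by rewrite /planar_lie !partial_z !mulr0 addr0. Qed.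

(** This and the next two lemmas are the commutators of V with the coordinate fields. They turn
    equations for f into equations of type V + 1 or V for its derivatives. *)
Lemma partial0_planar_lie f : D0 (V f) = V (D0 f) + D0 f + D1 f.
Proof.
rewrite /planar_lie !(partialD, partialM) !partial_x !partial_y.
rewrite (partial_comm i1 i0); move: (D0 (D0 f)) (D0 (D1 f)) (D0 f) (D1 f) => *.
ring.
Qed.

Lemma partial1_planar_lie f : D1 (V f) = V (D1 f) + D1 f.
Proof.
rewrite /planar_lie !(partialD, partialM) !partial_x !partial_y.
rewrite (partial_comm i1 i0); move: (D1 (D1 f)) (D0 (D1 f)) (D0 f) (D1 f) => *.
ring.
Qed.

Lemma partial2_planar_lie f : D2 (V f) = V (D2 f).
Proof.
rewrite /planar_lie !(partialD, partialM) !partial_x !partial_y.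
rewrite (partial_comm i2 i0) (partial_comm i2 i1).
move: (D0 (D2 f)) (D1 (D2 f)) (D0 f) (D1 f) => *; ring.
Qed.

Lemma x_at0 : x 0 = 0. Proof. by rewrite /= mxE. Qed.
Lemma y_at0 : y 0 = 0. Proof. by rewrite /= mxE. Qed.

Lemma planar_lie_at0 f : V f 0 = 0.
Proof. by rewrite planar_lieE !mxE addr0 !mul0r addr0. Qed.

(* planar_lie_at0 comes first: the later rules would unfold planar_lie. *)
Definition at0E := (planar_lie_at0, x_at0, y_at0, @Cinf_addE, @Cinf_oppE, @Cinf_mulE,
  @Cinf_zeroE, @Cinf_oneE).

Lemma constf_of_partials f : D0 f = 0 -> D1 f = 0 -> D2 f = 0 -> f = cst3 (f 0).
Proof.
move=> f0 f1 f2.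
have E i : partial i f = 0 -> f = coord_restr i f.
  by move=> fi; rewrite {1}(hadamard i f) fi coord_avg0 mulr0 addr0.
apply: Cinf_eq => pt /=.
rewrite {1}(E _ f0) coord_restrE {1}(E _ f1) coord_restrE {1}(E _ f2) coord_restrE.
by congr (f _); apply/rowP; elim/ord3P; rewrite !mulmx_dilation !mxE /=
  ?(mulr0, mul0r, mulr1).
Qed.

(** Restriction to the z-axis, the zero locus of V and of pi, extended constantly in x and y. *)
Definition axis f := coord_restr i1 (coord_restr i0 f).

Lemma axisE f pt : exists2 pt' : 'rV[R]_3,
  axis f pt = f pt' & pt' ord0 i0 = 0 /\ pt' ord0 i1 = 0.
Proof.
exists (pt *m dilation i1 0 *m dilation i0 0); first by rewrite /axis !coord_restrE.
by rewrite !mulmx_dilation /= ?(mulr0, mul0r).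
Qed.

Lemma partial_axis f : (D0 (axis f) = 0) * (D1 (axis f) = 0).
Proof. by rewrite /axis !partial_coord_restr /= coord_restr0. Qed.

Lemma axis_at0 f : axis f 0 = f 0.
Proof. by rewrite /axis !coord_restrE !mul0mx. Qed.

Lemma axis_constf f : D2 f = 0 -> axis f = cst3 (f 0).
Proof.
move=> f2; rewrite -axis_at0; apply: constf_of_partials; rewrite ?partial_axis //.
by rewrite /axis !partial_coord_restr /= f2 !coord_restr0.
Qed.

Lemma planar_hadamard f : exists a b, f = axis f + (x * a + y * b) /\
  (D2 f = 0 -> D2 a = 0 /\ D2 b = 0).
Proof.
exists (coord_avg i0 (D0 f)), (coord_avg i1 (D1 (coord_restr i0 f))); split.
  by rewrite {1}(hadamard i0 f) {1}(hadamard i1 (coord_restr i0 f)) -addrA [y * _ + _]addrC.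
move=> f2; split.
  by rewrite partial_coord_avg // (partial_comm i2 i0 f) f2 partial0 coord_avg0.
rewrite partial_coord_avg // (partial_comm i2 i1 (coord_restr i0 f)).
by rewrite partial_coord_restr /= f2 coord_restr0 partial0 coord_avg0.
Qed.

(* Differentiating V f = 0 in y gives (V + 1) f_y = 0, and V + 1 is injective. *)
Lemma planar_lie_eq0 f : V f = 0 -> D0 f = 0 /\ D1 f = 0.
Proof.
move=> Vf; have f1 : D1 f = 0.
  rewrite -[LHS]resolventK addrC -partial1_planar_lie Vf partial0.
  exact: resolvent0.
split=> //; rewrite -[LHS]resolventK addrC.
have := partial0_planar_lie f; rewrite Vf partial0 f1 addr0 => <-.
exact: resolvent0.
Qed.

Lemma planar_lie_eq0_constf f : D2 f = 0 -> V f = 0 -> f = cst3 (f 0).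
Proof. by move=> f2 /planar_lie_eq0[f0 f1]; exact: (constf_of_partials f0 f1 f2). Qed.

Lemma planar_lie_resolventE f : V (resolvent f) = f - resolvent f.
Proof. by apply/eqP; rewrite eq_sym subr_eq planar_lie_resolventD. Qed.

(** Write f = x a + y b and let K be [resolvent], so V K = 1 - K. Then V(x K a) = x a, V(y K b) = y
    b + x K b, and V(x K K b) = x K b cancels the error coming from V y = x + y. *)
Lemma planar_lie_surj f : D2 f = 0 -> f 0 = 0 ->
  exists2 l, D2 l = 0 & V l = f.
Proof.
move=> f2 f0; have [a [b [fE /(_ f2)[a2 b2]]]] := planar_hadamard f.
have {}fE : f = x * a + y * b.
  rewrite {1}fE axis_constf // f0; apply: Cinf_eq => pt.
  by rewrite Cinf_addE /= add0r.
have Ka := planar_lie_resolventE a; have Kb := planar_lie_resolventE b.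
have Kc := planar_lie_resolventE (resolvent b).
exists (x * resolvent a + y * resolvent b - x * resolvent (resolvent b)).
  rewrite !(partialD, partialN, partialM) !partial_x !partial_y !partial2_resolvent.
  by rewrite a2 b2 !resolvent0 !(mulr0, mul0r, addr0, subr0).
rewrite !(planar_lieD, planar_lieN, planar_lieM) planar_lie_x planar_lie_y Ka Kb Kc fE.
move: (resolvent (resolvent b)) (resolvent b) (resolvent a) => *; ring.
Qed.

Lemma planar_lie_surj_constf f : D2 f = 0 ->
  exists2 l, D2 l = 0 & V l = f - cst3 (f 0).
Proof.
move=> f2; apply: planar_lie_surj; first by rewrite partialD partialN partial_constf f2 subr0.
by rewrite Cinf_addE Cinf_oppE /= subrr.
Qed.

(** For g = g(0) + x a + y b, the ansatz x h + y e reduces the linear part to V e = b and V h = a -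
    e. Solvability requires b(0) = 0, which is the hypothesis, and e(0) = a(0). *)
Lemma planar_lie_sub1_surj g : D2 g = 0 -> D1 g 0 = 0 ->
  exists2 a, D2 a = 0 & V a - a = g.
Proof.
move=> g2 g10; have [a [b [gE /(_ g2)[a2 b2]]]] := planar_hadamard g.
rewrite axis_constf // in gE.
have b0 : b 0 = 0.
  rewrite -g10 gE !(partialD, partialM) partial_constf partial_x partial_y.
  by rewrite !(Cinf_addE, Cinf_mulE) x_at0 y_at0 Cinf_zeroE Cinf_oneE
    !(mul0r, mul1r, add0r, addr0).
have [hb hb2 Vhb] := planar_lie_surj b2 b0.
(* The solution e is free up to a constant, which is spent on making a - e vanish at 0. *)
have [e [e2 Ve e0]] : exists e, [/\ D2 e = 0, V e = b & e 0 = a 0].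
  exists (hb + cst3 (a 0 - hb 0)).
  rewrite partialD partial_constf hb2 planar_lieD planar_lie_constf addr0 Vhb.
  by split=> //; rewrite ?addr0 // Cinf_addE /= addrCA subrr addr0.
have ae2 : D2 (a - e) = 0 by rewrite partialD partialN a2 e2 subr0.
have ae0 : (a - e) 0 = 0 by rewrite Cinf_addE Cinf_oppE e0 subrr.
have [ha ha2 Vha] := planar_lie_surj ae2 ae0.
exists (x * ha + y * e - cst3 (g 0)).
  rewrite !(partialD, partialN, partialM) partial_constf !partial_x !partial_y.
  by rewrite e2 ha2 !(mulr0, mul0r, addr0, subr0).
rewrite [RHS]gE !(planar_lieD, planar_lieN, planar_lieM) planar_lie_x planar_lie_y.
rewrite planar_lie_constf Vha Ve; ring.
Qed.

(** The hypotheses say that a d_x + b d_y commutes with V. The commutators make the first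
    derivatives constant one after the other; evaluating at 0, where V f vanishes, gives a_y = 0 and
    b_y = a_x, the centralizer of a Jordan block. *)
Lemma planar_lie_kernel a b : D2 a = 0 -> D2 b = 0 -> V a = a -> V b = a + b ->
  exists k l : R, a = cst3 k * x /\ b = cst3 l * x + cst3 k * y.
Proof.
move=> a2 b2 Va Vb.
have D2i i f : D2 f = 0 -> D2 (partial i f) = 0.
  by move=> f2; rewrite partial_comm f2 partial0.
have a1E : D1 a = cst3 (D1 a 0).
  apply: planar_lie_eq0_constf; first exact: D2i.
  apply/eqP; have := partial1_planar_lie a; rewrite Va => /eqP.
  by rewrite eq_sym -subr_eq0 addrK.
have Va0 : V (D0 a) = - D1 a.
  have := partial0_planar_lie a; rewrite Va addrAC => /eqP.
  by rewrite eq_sym -subr_eq0 addrK addr_eq0 => /eqP.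
have a1 : D1 a = 0.
  rewrite a1E; have := planar_lie_at0 (D0 a); rewrite Va0 Cinf_oppE => /eqP.
  by rewrite oppr_eq0 => /eqP ->; apply: Cinf_eq.
have a0E : D0 a = cst3 (D0 a 0).
  by apply: planar_lie_eq0_constf; [exact: D2i|rewrite Va0 a1 oppr0].
have b1E : D1 b = cst3 (D1 b 0).
  apply: planar_lie_eq0_constf; first exact: D2i.
  apply/eqP; have := partial1_planar_lie b; rewrite Vb partialD a1 add0r => /eqP.
  by rewrite eq_sym -subr_eq0 addrK.
have Vb0 : V (D0 b) = D0 a - D1 b.
  have := partial0_planar_lie b; rewrite Vb partialD addrAC => /addIr ->.
  by rewrite addrK.
have ba : D1 b = D0 a.
  rewrite a0E b1E; have := planar_lie_at0 (D0 b); rewrite Vb0 Cinf_addE Cinf_oppE.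
  by move/eqP; rewrite subr_eq0 => /eqP ->.
have b0E : D0 b = cst3 (D0 b 0).
  by apply: planar_lie_eq0_constf; [exact: D2i|rewrite Vb0 ba subrr].
exists (D0 a 0), (D0 b 0); split.
  apply/eqP; rewrite -subr_eq0; apply/eqP.
  rewrite (@constf_of_partials (a - _)) ?(partialD, partialN, partialM);
    rewrite ?partial_constf ?partial_x.
  - rewrite Cinf_addE Cinf_oppE Cinf_mulE x_at0 mulr0 subr0 -Va planar_lie_at0.
    exact: Cinf_eq.
  - by rewrite -a0E mul0r mulr1 addr0 subrr.
  - by rewrite a1 mul0r mulr0 addr0 subrr.
  - by rewrite a2 mul0r mulr0 addr0 subrr.
apply/eqP; rewrite -subr_eq0; apply/eqP.
rewrite (@constf_of_partials (b - _)) ?(partialD, partialN, partialM);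
  rewrite ?partial_constf ?partial_x ?partial_y.
- rewrite !(Cinf_addE, Cinf_oppE, Cinf_mulE) x_at0 y_at0 !mulr0 addr0 subr0.
  have -> : b = V b - V a by rewrite Vb Va addrAC subrr add0r.
  rewrite Cinf_addE Cinf_oppE !planar_lie_at0 subrr.
  exact: Cinf_eq.
- by rewrite -b0E !(mul0r, mulr0, mulr1, addr0) subrr.
- by rewrite ba -a0E !(mul0r, mulr0, mulr1, addr0, add0r) subrr.
- by rewrite b2 !(mul0r, mulr0, mulr1, addr0, add0r) oppr0.
Qed.

(** On x = 0 the equation reads 0 = y p, so p vanishes there and x divides p; then x cancels. *)
Lemma parallel_to_field p q : x * q = (x + y) * p ->
  exists h, p = x * h /\ q = (x + y) * h.
Proof.
move=> pq.
have yp0 : y * coord_restr i0 p = 0.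
  apply: Cinf_eq => pt; rewrite Cinf_mulE coord_restrE Cinf_zeroE.
  have := congr1 (fun f : A => f (pt *m dilation i0 0)) pq.
  rewrite !Cinf_mulE Cinf_addE.
  rewrite [x _]mulmx_dilation [y _]mulmx_dilation /= mulr0 mul0r add0r mulr1.
  by move/esym.
have p0 := coord_mul_eq0 yp0.
exists (coord_avg i0 (D0 p)); have pE := hadamard i0 p; rewrite p0 add0r in pE.
split=> //; apply/eqP; rewrite -subr_eq0; apply/eqP.
apply: (@coord_mul_eq0 _ _ i0); rewrite -/(cx R) mulrBr pq {1}pE.
by rewrite -/(cx R) mulrCA subrr.
Qed.

Definition zprim f := z * coord_avg i2 f.

Lemma partial_zprim f : D2 (zprim f) = f.
Proof. exact: partial_coord_mul_avg. Qed.

(** The hypotheses are the three components of closedness of (a, b, c); the conclusion writes it as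
    k x d_y + l d_z + d f. *)
Lemma H1_normal_form a b c :
    x * D2 b - (x + y) * D2 a = 0 ->
    V a - a + x * D2 c = 0 -> V b - a - b + (x + y) * D2 c = 0 ->
  exists k l f, [/\ a = x * D2 f, b = cst3 k * x + (x + y) * D2 f
                  & c = cst3 l - V f].
Proof.
move=> /eqP; rewrite subr_eq0 => /eqP /parallel_to_field[h [a2 b2]] Ea Eb.
(* Subtracting d f1 with second z-derivative h makes the planar components a', b' independent of
   z. *)
have [g1 g1E] : exists g1, D2 g1 = h by exists (zprim h); exact: partial_zprim.
have [f1 f1E] : exists f1, D2 f1 = g1 by exists (zprim g1); exact: partial_zprim.
have [a' a'E] : exists a', a' = a - x * g1 by exists (a - x * g1).
have [b' b'E] : exists b', b' = b - (x + y) * g1 by exists (b - (x + y) * g1).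
have [c' c'E] : exists c', c' = c + V f1 by exists (c + V f1).
have a'2 : D2 a' = 0.
  by rewrite a'E partialD partialN partialM partial_x a2 g1E mul0r addr0 subrr.
have b'2 : D2 b' = 0.
  rewrite b'E partialD partialN partialM partialD partial_x partial_y b2 g1E.
  by rewrite addr0 mul0r addr0 subrr.
have [k kE] : exists k : A, k = D2 c' by exists (D2 c').
have kE' : k = D2 c + V g1 by rewrite kE c'E partialD partial2_planar_lie f1E.
have Ea' : V a' - a' + x * k = 0.
  rewrite -Ea kE' a'E planar_lieD planar_lieN planar_lieM planar_lie_x; ring.
have Eb' : V b' - a' - b' + (x + y) * k = 0.
  rewrite -Eb kE' a'E b'E planar_lieD planar_lieN planar_lieM planar_lieD.
  rewrite planar_lie_x planar_lie_y; ring.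
have k2 : D2 k = 0.
  apply: (@coord_mul_eq0 _ _ i0); rewrite -/(cx R).
  have := congr1 D2 Ea'; rewrite partialD partialD partialN partialM partial_x.
  by rewrite partial2_planar_lie a'2 planar_lie0 partial0 mul0r !addr0 subr0 add0r.
(* The linear Taylor coefficients at 0 give a'_y + k = 0 from the first equation and k - a'_y = 0
   from the second. *)
have k0 : k 0 = 0.
  have := congr1 (fun f : A => f 0) (congr1 D0 Ea').
  rewrite !(partial0_planar_lie, partialD, partialN, partialM) partial_x partial0.
  rewrite !at0E => E1.
  have := congr1 (fun f : A => f 0) (congr1 D1 Eb').
  rewrite !(partial1_planar_lie, partialD, partialN, partialM) partial_x partial_y.
  rewrite partial0.
  rewrite !at0E => E2.
  lra.
have [g g2 Vg] := planar_lie_surj k2 k0.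
have a''2 : D2 (a' + x * g) = 0.
  by rewrite partialD partialM partial_x a'2 g2 mulr0 mul0r !addr0.
have b''2 : D2 (b' + (x + y) * g) = 0.
  by rewrite partialD partialM partialD partial_x partial_y b'2 g2
    !(mulr0, mul0r, addr0).
have Va'' : V (a' + x * g) = a' + x * g.
  rewrite planar_lieD planar_lieM planar_lie_x Vg; apply/eqP; rewrite -subr_eq0.
  rewrite -[X in _ == X]Ea'; apply/eqP; ring.
have Vb'' : V (b' + (x + y) * g) = a' + x * g + (b' + (x + y) * g).
  rewrite planar_lieD planar_lieM planar_lieD planar_lie_x planar_lie_y Vg.
  apply/eqP; rewrite -subr_eq0 -[X in _ == X]Eb'; apply/eqP; ring.
have [al [ga [aE bE]]] := planar_lie_kernel a''2 b''2 Va'' Vb''.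
have [c2 c2E] : exists c2, c2 = c' - z * k by exists (c' - z * k).
have c22 : D2 c2 = 0.
  by rewrite c2E partialD partialN partialM partial_z k2 mulr0 add0r mul1r -kE subrr.
have [l l2 Vl] := planar_lie_surj_constf c22.
(* The centralizer part is al V + (ga - al) x d_y, and al V = d(al z); this accounts for the term al
   z in f and the coefficient ga - al. *)
have galE : cst3 (ga - al) = cst3 ga - cst3 al by exact: Cinf_eq.
have fE : D2 (f1 - z * g + cst3 al * z - l) = g1 - g + cst3 al.
  rewrite !(partialD, partialN, partialM) partial_constf partial_z f1E g2 l2.
  by rewrite !(mulr0, mul0r, mulr1, mul1r, addr0, add0r, subr0).
exists (ga - al), (c2 0), (f1 - z * g + cst3 al * z - l); rewrite fE galE; split.
- have -> : a = a' + x * g1 by rewrite a'E subrK.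
  have -> : a' = cst3 al * x - x * g by rewrite -aE addrK.
  ring.
- have -> : b = b' + (x + y) * g1 by rewrite b'E subrK.
  have -> : b' = cst3 ga * x + cst3 al * y - (x + y) * g by rewrite -bE addrK.
  ring.
- rewrite !(planar_lieD, planar_lieN, planar_lieM) planar_lie_z planar_lie_constf Vg Vl.
  have -> : c = c' - V f1 by rewrite c'E addrK.
  move: c2E (cst3 (c2 0)) => -> k0'; ring.
Qed.

(** The hypothesis is closedness of the bivector field (p, q, r); the conclusion writes it as k y
    d_x wedge d_z + d(a, b, c). *)
Lemma H2_normal_form p q r :
    x * D2 r - (x + y) * D2 q - V p + 2%:R * p = 0 ->
  exists k a b c, [/\ p = x * D2 b - (x + y) * D2 a,
    q = cst3 k * y + (V a - a + x * D2 c)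
  & r = V b - a - b + (x + y) * D2 c].
Proof.
move=> E.
(* On the z-axis all other terms of the closedness equation vanish, leaving 2 p = 0. *)
have axp : axis p = 0.
  apply: Cinf_eq => pt; have [pt' -> [x0 y0]] := axisE p pt.
  have : x pt' * D2 r pt' - (x pt' + y pt') * D2 q pt' - V p pt'
      + (1 + 1) * p pt' = 0 := congr1 (fun f : A => f pt') E.
  rewrite planar_lieE [x pt']x0 [y pt']y0 x0 y0.
  rewrite !(mul0r, add0r, oppr0, addr0) => /eqP.
  by rewrite mulf_eq0 -[1 + 1]/(2%:R) pnatr_eq0 /= => /eqP ->.
have [al [be [pE _]]] := planar_hadamard p; rewrite axp add0r in pE.
(* Chosen so that x (al - be) + (x + y) be = x al + y be = p; subtracting d(a0, b0, 0) removes p. *)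
have [b0 b0E] : exists b0, D2 b0 = al - be.
  by exists (zprim (al - be)); exact: partial_zprim.
have [a0 a0E] : exists a0, D2 a0 = - be.
  by exists (zprim (- be)); exact: partial_zprim.
have pE' : p = x * D2 b0 - (x + y) * D2 a0 by rewrite pE b0E a0E; ring.
have [q' q'E] : exists q', q' = q - (V a0 - a0) by exists (q - (V a0 - a0)).
have [r' r'E] : exists r', r' = r - (V b0 - a0 - b0) by exists (r - (V b0 - a0 - b0)).
have /parallel_to_field[h [q'2 r'2]] : x * D2 r' = (x + y) * D2 q'.
  apply/eqP; rewrite -subr_eq0 -[X in _ == X]E r'E q'E.
  rewrite !(partial2_planar_lie, partialD, partialN) pE'.
  rewrite !(planar_lieD, planar_lieN, planar_lieM) planar_lie_x planar_lie_y.
  apply/eqP; ring.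
have [h1 h1E] : exists h1, D2 h1 = h by exists (zprim h); exact: partial_zprim.
have [c0 c0E] : exists c0, D2 c0 = h1 by exists (zprim h1); exact: partial_zprim.
have [q2 q2E] : exists q2, q2 = q' - x * h1 by exists (q' - x * h1).
have [r2 r2E] : exists r2, r2 = r' - (x + y) * h1 by exists (r' - (x + y) * h1).
have q22 : D2 q2 = 0.
  by rewrite q2E partialD partialN partialM partial_x q'2 h1E mul0r addr0 subrr.
have r22 : D2 r2 = 0.
  rewrite r2E partialD partialN partialM partialD partial_x partial_y r'2 h1E.
  by rewrite addr0 mul0r addr0 subrr.
(* [ka] removes the obstruction in the first equation and is the coefficient of the class. [ka2]
   removes the one in the second, where a1 contributes D0 q2 0 - [ka2]; it multiplies pi = d(z d_z)
   and is absorbed by c. *)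
pose ka : R := D1 q2 0; pose ka2 : R := (D0 q2 0 + D1 r2 0) / 2.
have [a1 a12 a1E] : exists2 a1, D2 a1 = 0 & V a1 - a1 = q2 - cst3 ka * y - cst3 ka2 * x.
  apply: planar_lie_sub1_surj.
    rewrite !(partialD, partialN, partialM) !partial_constf partial_x partial_y q22.
    by rewrite !(mulr0, mul0r, addr0, subr0).
  rewrite !(partialD, partialN, partialM) !partial_constf partial_x partial_y.
  rewrite !(Cinf_addE, Cinf_oppE, Cinf_mulE) !(Cinf_zeroE, Cinf_oneE) /=.
  by rewrite !(mulr0, mul0r, mulr1, addr0, subr0) subrr.
have a11 : D1 a1 0 = D0 q2 0 - ka2.
  have := congr1 (fun f : A => f 0) (congr1 D0 a1E).
  rewrite !(partial0_planar_lie, partialD, partialN, partialM) !partial_constf.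
  rewrite partial_x partial_y !at0E /=.
  move=> H; lra.
have [b1 b12 b1E] : exists2 b1, D2 b1 = 0 & V b1 - b1 = r2 - cst3 ka2 * (x + y) + a1.
  apply: planar_lie_sub1_surj.
    rewrite !(partialD, partialN, partialM) partial_constf partial_x partial_y r22 a12.
    by rewrite !(mulr0, mul0r, addr0, subr0).
  rewrite !(partialD, partialN, partialM) partial_constf partial_x partial_y.
  rewrite !at0E /= a11 /ka2.
  by field.
exists ka, (a0 + a1), (b0 + b1), (c0 + cst3 ka2 * z).
rewrite !(partialD, partialM) !planar_lieD a12 b12 c0E partial_constf partial_z.
split.
- by rewrite !addr0.
- have -> : V a1 = a1 + (q2 - cst3 ka * y - cst3 ka2 * x) by rewrite -a1E addrC subrK.
  rewrite q2E; have -> : q = q' + (V a0 - a0) by rewrite q'E subrK.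
  ring.
- have -> : V b1 = b1 + (r2 - cst3 ka2 * (x + y) + a1) by rewrite -b1E addrC subrK.
  rewrite r2E; have -> : r = r' + (V b0 - a0 - b0) by rewrite r'E subrK.
  ring.
Qed.

(** Half the restriction of w to the axis serves as p, since V kills it; q and r produce the rest x
    al + y be. *)
Lemma H3_normal_form w :
  exists p q r, w = x * D2 r - (x + y) * D2 q - V p + 2%:R * p.
Proof.
have [al [be [wE _]]] := planar_hadamard w.
have [q qE] : exists q, D2 q = - be by exists (zprim (- be)); exact: partial_zprim.
have [r rE] : exists r, D2 r = al - be.
  by exists (zprim (al - be)); exact: partial_zprim.
exists (cst3 2^-1 * axis w), q, r; rewrite qE rE.
have Vax : V (axis w) = 0.
  by rewrite /planar_lie !partial_axis !mulr0 addr0.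
rewrite planar_lieM planar_lie_constf Vax mulr0 mul0r addr0 subr0 mulrA.
have -> : 2%:R * cst3 2^-1 = 1 :> A.
  apply: Cinf_eq => pt; rewrite Cinf_mulE -[(2%:R : A) pt]/(1 + 1 : R).
  by rewrite Cinf_oneE /=; field.
rewrite {1}wE; ring.
Qed.

End PlanarEquations.

(** * Cocycles up to coboundaries *)

Section PoissonCohomologyR3.
Variable R : realType.
Local Notation A := (Cinf R 3).
Local Notation MV := (multivector R 3).
Implicit Types (P Q X Y : MV) (f g : A) (k l m : R).

Local Notation x := (cx R).
Local Notation y := (cy R).
Local Notation V := (@planar_lie R).
Local Notation D0 := (partial i0).
Local Notation D1 := (partial i1).
Local Notation D2 := (partial i2).
Local Notation cst3 := (@constf R 3).
Local Notation d := (dpi (pi3 R)).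
Local Notation xdy := (cx R *: dy R).
Local Notation ydxdz := (cy R *: wedge (dx R) (dz R)).

Definition vect (a b c : A) : MV := mvec (fun b0 b1 b2 =>
  match b0, b1, b2 with
  | true, false, false => a | false, true, false => b | false, false, true => c
  | _, _, _ => 0 end).

Definition bivect (p q r : A) : MV := mvec (fun b0 b1 b2 =>
  match b0, b1, b2 with
  | true, true, false => p | true, false, true => q | false, true, true => r
  | _, _, _ => 0 end).

Lemma homog_bsetP (n : nat) P : (forall b0 b1 b2 : bool,
  (b0 + b1 + b2)%N != n -> P (bset b0 b1 b2) = 0) -> homog n P.
Proof. by move=> H; elim/bset_ind => b0 b1 b2; rewrite card_bset; exact: H. Qed.

Lemma homog_vect a b c : homog 1 (vect a b c).
Proof. by apply: homog_bsetP => -[] [] [] //; rewrite mvecE. Qed.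

Lemma homog_bivect a b c : homog 2 (bivect a b c).
Proof. by apply: homog_bsetP => -[] [] [] //; rewrite mvecE. Qed.

Lemma xdyE : xdy = vect 0 x 0.
Proof.
apply: mv_eq => b0 b1 b2; rewrite mvecE mv_scaleE basis_mvE set1_bset bset_eq.
by case: b0 b1 b2 => [] [] [] /=; rewrite ?mulr0 ?mulr1.
Qed.

Lemma dzE : dz R = vect 0 0 1.
Proof.
apply: mv_eq => b0 b1 b2; rewrite mvecE basis_mvE set1_bset bset_eq.
by case: b0 b1 b2 => [] [] [].
Qed.

Lemma dxE : dx R = vect 1 0 0.
Proof.
apply: mv_eq => b0 b1 b2; rewrite mvecE basis_mvE set1_bset bset_eq.
by case: b0 b1 b2 => [] [] [].
Qed.

Lemma ydxdzE : ydxdz = bivect 0 y 0.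
Proof.
apply: mv_eq => b0 b1 b2; rewrite mvecE mv_scaleE dxE dzE wedge_bset !big_bool.
case: b0 b1 b2 => [] [] []; rewrite /= ?mvecE /= ?(expr0, expr1); ring.
Qed.

Lemma dpi_cstZ k P : d (cst3 k *: P) = cst3 k *: d P.
Proof. by rewrite /dpi schoutenZ schouten_cst wedge0l addr0. Qed.

Lemma dpiD P Q : d (P + Q) = d P + d Q. Proof. exact: schoutenD. Qed.

Lemma dpiN P : d (- P) = - d P. Proof. exact: schoutenN. Qed.

Lemma wedge_dpi_fun f Q : d Q = 0 -> wedge (d (fun_mv f)) Q = d (f *: Q).
Proof. by rewrite /dpi schoutenZ => ->; rewrite scaler0 add0r. Qed.

Lemma dpi_fun f : d (fun_mv f) = vect (x * D2 f) ((x + y) * D2 f) (- V f).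
Proof.
apply: (homog_eq (homog_dpi (homog_fun f)) (homog_vect _ _ _)) => b0 b1 b2 b.
by rewrite mvecE dpi3_bset; case: b0 b1 b2 b => [] [] [] //= _; rewrite fun_mv_bset0.
Qed.

Lemma dpi_vect a b c : d (vect a b c) =
  bivect (x * D2 b - (x + y) * D2 a) (V a - a + x * D2 c)
         (V b - a - b + (x + y) * D2 c).
Proof.
apply: (homog_eq (homog_dpi (homog_vect a b c)) (homog_bivect _ _ _)) => b0 b1 b2 b'.
by rewrite mvecE dpi3_bset; case: b0 b1 b2 b' => [] [] [] //= _; rewrite !mvecE.
Qed.

Lemma homog1E P : homog 1 P -> P = vect (P (bset true false false))
  (P (bset false true false)) (P (bset false false true)).
Proof.
move=> hP; apply: (homog_eq hP (homog_vect _ _ _)) => b0 b1 b2.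
by rewrite mvecE; case: b0 b1 b2 => [] [] [].
Qed.

Lemma homog2E P : homog 2 P -> P = bivect (P (bset true true false))
  (P (bset true false true)) (P (bset false true true)).
Proof.
move=> hP; apply: (homog_eq hP (homog_bivect _ _ _)) => b0 b1 b2.
by rewrite mvecE; case: b0 b1 b2 => [] [] [].
Qed.

Lemma homog0E P : homog 0 P -> P = fun_mv (P (bset false false false)).
Proof.
move=> hP; apply: (homog_eq hP (homog_fun _)) => b0 b1 b2.
by case: b0 b1 b2 => [] [] [] //= _; rewrite fun_mv_bset0.
Qed.

Lemma vectD a b c a' b' c' :
  vect a b c + vect a' b' c' = vect (a + a') (b + b') (c + c').
Proof.
by apply: mv_eq => -[] [] []; rewrite mv_addE !mvecE ?addr0.
Qed.

Lemma vectZ f a b c : f *: vect a b c = vect (f * a) (f * b) (f * c).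
Proof. by apply: mv_eq => -[] [] []; rewrite mv_scaleE !mvecE ?mulr0. Qed.

Lemma bivectD a b c a' b' c' :
  bivect a b c + bivect a' b' c' = bivect (a + a') (b + b') (c + c').
Proof.
by apply: mv_eq => -[] [] []; rewrite mv_addE !mvecE ?addr0.
Qed.

Lemma bivectZ f a b c : f *: bivect a b c = bivect (f * a) (f * b) (f * c).
Proof. by apply: mv_eq => -[] [] []; rewrite mv_scaleE !mvecE ?mulr0. Qed.

Lemma vect_inj a b c a' b' c' :
  vect a b c = vect a' b' c' -> [/\ a = a', b = b' & c = c'].
Proof.
move=> E; split; [have := congr1 (fun P : MV => P (bset true false false)) E
  |have := congr1 (fun P : MV => P (bset false true false)) E
  |have := congr1 (fun P : MV => P (bset false false true)) E]; by rewrite !mvecE.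
Qed.

Lemma bivect_inj a b c a' b' c' :
  bivect a b c = bivect a' b' c' -> [/\ a = a', b = b' & c = c'].
Proof.
move=> E; split; [have := congr1 (fun P : MV => P (bset true true false)) E
  |have := congr1 (fun P : MV => P (bset true false true)) E
  |have := congr1 (fun P : MV => P (bset false true true)) E]; by rewrite !mvecE.
Qed.

Lemma vect0 : vect 0 0 0 = 0.
Proof. by apply: mv_eq => -[] [] []; rewrite mvecE mv_zeroE. Qed.

Lemma bivect0 : bivect 0 0 0 = 0.
Proof. by apply: mv_eq => -[] [] []; rewrite mvecE mv_zeroE. Qed.

(** The general closed vector field, by [cocycle1_normal]. *)
Definition normal1 k l f : MV := cst3 k *: xdy + cst3 l *: dz R + d (fun_mv f).

Lemma normal1E k l f :
  normal1 k l f = vect (x * D2 f) (cst3 k * x + (x + y) * D2 f) (cst3 l - V f).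
Proof.
rewrite /normal1 xdyE dzE dpi_fun !vectZ !vectD.
by rewrite !(mulr0, mulr1, add0r, addr0).
Qed.

Lemma casimir_cst f : d (fun_mv f) = 0 -> f = cst3 (f 0).
Proof.
rewrite dpi_fun -vect0 => /vect_inj[xf _ Vf].
apply: planar_lie_eq0_constf; first exact: coord_mul_eq0 xf.
by apply/eqP; rewrite -oppr_eq0; apply/eqP.
Qed.

Lemma dpi_xdy : d xdy = 0.
Proof.
rewrite xdyE dpi_vect -bivect0 !partial0 partial_x planar_lie0 planar_lie_x.
by rewrite !(mulr0, subr0, addr0, subrr).
Qed.

Lemma dpi_dz : d (dz R) = 0.
Proof.
have D21 : D2 1 = 0 := partial_nat R i2 1.
rewrite dzE dpi_vect -bivect0 !partial0 D21 planar_lie0.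
by rewrite !(mulr0, subr0, addr0, subrr).
Qed.

Lemma homog_ydxdz : homog 2 ydxdz.
Proof. by rewrite ydxdzE; exact: homog_bivect. Qed.

Lemma homog_xdy : homog 1 xdy.
Proof. by rewrite xdyE; exact: homog_vect. Qed.

Lemma dpi_ydxdz : d ydxdz = 0.
Proof.
apply: (homog_eq (homog_dpi homog_ydxdz) (@homog0 R 3 3)) => b0 b1 b2 b.
rewrite mv_zeroE dpi3_bset ydxdzE; case: b0 b1 b2 b => [] [] [] //= _.
rewrite !mvecE !partial0 partial_y planar_lie0.
by rewrite !(mulr0, subr0, addr0).
Qed.

Lemma cocycle1_normal P : homog 1 P -> d P = 0 -> exists k l f, P = normal1 k l f.
Proof.
move=> /homog1E; move: (P _) (P _) (P _) => a b c ->.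
rewrite dpi_vect -bivect0 => /bivect_inj[E1 E2 E3].
have [k [l [f [-> -> ->]]]] := H1_normal_form E1 E2 E3.
by exists k, l, f; rewrite normal1E.
Qed.

Lemma cocycle2_normal P : homog 2 P -> d P = 0 ->
  exists k Y, homog 1 Y /\ P = cst3 k *: ydxdz + d Y.
Proof.
move=> /homog2E; move: (P _) (P _) (P _) => p q r -> dP.
have := congr1 (fun P : MV => P (bset true true true)) dP.
rewrite mv_zeroE dpi3_bset /= !mvecE => /H2_normal_form[k [a [b [c [-> -> ->]]]]].
exists k, (vect a b c); split; first exact: homog_vect.
by rewrite ydxdzE dpi_vect bivectZ bivectD !(mulr0, add0r).
Qed.

Lemma homog3_exact P : homog 3 P -> exists2 Q, homog 2 Q & P = d Q.
Proof.
move=> hP; have [p [q [r E]]] := H3_normal_form (P (bset true true true)).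
exists (bivect p q r); first exact: homog_bivect.
apply: (homog_eq hP (homog_dpi (homog_bivect p q r))) => b0 b1 b2 b.
by rewrite dpi3_bset; case: b0 b1 b2 b => [] [] [] //= _; rewrite !mvecE.
Qed.

Lemma coboundary1_eq0 k l Q :
  homog 0 Q -> cst3 k *: xdy + cst3 l *: dz R = d Q -> k = 0 /\ l = 0.
Proof.
move=> /homog0E ->; move: (Q _) => f.
rewrite dpi_fun xdyE dzE !vectZ vectD !(mulr0, addr0, add0r, mulr1).
move=> /vect_inj[/esym/coord_mul_eq0 f2 kx lV].
rewrite f2 mulr0 in kx.
have k0 : cst3 k = 0 by apply: (@coord_mul_eq0 _ _ i0); rewrite mulrC.
split; first exact: (congr1 (fun f : A => f 0) k0).
have := congr1 (fun f : A => f 0) lV.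
by rewrite Cinf_oppE planar_lie_at0 oppr0.
Qed.

(** The y-derivative at 0 of the d_x d_z component V a - a + x c_z always vanishes. *)
Lemma coboundary2_eq0 k Q : homog 1 Q -> cst3 k *: ydxdz = d Q -> k = 0.
Proof.
move=> /homog1E ->; move: (Q _) (Q _) (Q _) => a b c.
rewrite dpi_vect ydxdzE bivectZ => /bivect_inj[_ E _].
have := congr1 D1 E.
rewrite !(partial1_planar_lie, partialD, partialN, partialM).
rewrite partial_constf !partial_x !partial_y mulr1 !mul0r !addr0 addrK => kE.
have := congr1 (fun f : A => f 0) kE.
by rewrite Cinf_addE planar_lie_at0 Cinf_mulE x_at0 mul0r addr0.
Qed.

Lemma wedge_normal1 k l f k' l' g :
  exists2 Q, homog 1 Q & wedge (normal1 k l f) (normal1 k' l' g) = d Q.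
Proof.
have hP0 m n : homog 1 (cst3 m *: xdy + cst3 n *: dz R).
  by apply: homogD; apply: homogZ; [exact: homog_xdy|exact: homog_pd].
have dP0 m n : d (cst3 m *: xdy + cst3 n *: dz R) = 0.
  by rewrite dpiD !dpi_cstZ dpi_xdy dpi_dz !scaler0 addr0.
have dN m n h : d (normal1 m n h) = 0.
  by rewrite /normal1 dpiD dP0 dpi3_dpi3 addr0.
exists (f *: normal1 k' l' g - g *: (cst3 k *: xdy + cst3 l *: dz R) +
        cst3 (k * l' - l * k') *: vect 0 y 0).
  apply: homogD; last by apply: homogZ; exact: homog_vect.
  apply: homogD; last by apply: homogN; exact: homogZ.
  by apply: homogZ; apply: homogD; last exact: homog_dpi (homog_fun g).
rewrite !dpiD dpiN dpi_cstZ.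
rewrite -(wedge_dpi_fun f (dN k' l' g)) -(wedge_dpi_fun g (dP0 k l)).
rewrite -(wedge1_anticomm (homog_dpi (homog_fun g)) (hP0 k l)).
rewrite [LHS]wedgeDl {1}/normal1 [X in X + _ = _]wedgeDr [X in X + _ = _]addrC.
rewrite [LHS]addrC addrA; congr (_ + _).
have -> : cst3 (k * l' - l * k') = cst3 k * cst3 l' - cst3 l * cst3 k'.
  exact: Cinf_eq.
rewrite !xdyE !dzE !vectZ !vectD dpi_vect bivectZ.
apply: mv_eq => -[] [] []; rewrite wedge_bset !big_bool /= !mvecE /=;
  rewrite ?(expr0, expr1) ?partial0 ?partial_y ?planar_lie0 ?planar_lie_y.
all: ring.
Qed.

Lemma schouten_normal1 k l f k' l' :
  schouten (normal1 k l f) (cst3 k' *: xdy + cst3 l' *: dz R) =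
  d (fun_mv (- (cst3 k' * x * D1 f + cst3 l' * D2 f))).
Proof.
have hX : homog 1 (normal1 k l f) by rewrite normal1E; exact: homog_vect.
rewrite xdyE dzE !vectZ vectD !(mulr0, mulr1, add0r, addr0).
have hQ := homog_vect 0 (cst3 k' * x) (cst3 l').
apply: (homog_eq (homog_schouten hX hQ) (homog_dpi (homog_fun _))) => b0 b1 b2 b.
rewrite dpi_fun (schouten1_bset _ _ _ _ hX) /derivation normal1E.
rewrite !(partial0, planar_lieN, planar_lieD, planar_lieM).
case: b0 b1 b2 b => [] [] [] //= _; rewrite !mvecE.
all: rewrite ?planar_lie_constf ?planar_lie_x ?partial0.
all: rewrite ?(partial0_planar_lie, partial1_planar_lie, partial2_planar_lie, partialD,
  partialN, partialM) !partial_constf.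
all: rewrite ?partial_x ?partial_y.
all: rewrite ?(partial_comm i1 i0 f) ?(partial_comm i2 i1 f) ?(partial_comm i2 i0 f).
all: rewrite /planar_lie; cinf_ring R.
Qed.

Lemma schouten_normal1_ydxdz k l f :
  schouten (normal1 k l f) ydxdz =
  d (vect (cst3 k * y + y * D2 f) 0 (- (y * D0 f))).
Proof.
have hX : homog 1 (normal1 k l f) by rewrite normal1E; exact: homog_vect.
apply: (homog_eq (homog_schouten hX homog_ydxdz) (homog_dpi (homog_vect _ _ _))).
move=> b0 b1 b2 b.
rewrite dpi_vect (schouten1_bset _ _ _ _ hX) /derivation normal1E ydxdzE.
case: b0 b1 b2 b => [] [] [] //= _; rewrite !mvecE.
all: rewrite /planar_lie /cx /cy;
  rewrite ?(partial0, partialD, partialN, partialM, partial_coord) /= !partial_constf.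
all: cinf_ring R.
Qed.

End PoissonCohomologyR3.

Section CohomologyClasses.
Variables (R : realType).
Local Notation A := (Cinf R 3).
Local Notation MV := (multivector R 3).
Local Notation H := (cohomology (pi3 R)).
Local Notation cst3 := (@constf R 3).
Local Notation d := (dpi (pi3 R)).
Local Notation xdy := (cx R *: dy R).
Local Notation ydxdz := (cy R *: wedge (dx R) (dz R)).
Implicit Types (P Q : MV) (k : nat) (l m : R).

Definition mk_cocycle k P (hP : homog k P) (dP : d P = 0) : cocycle (pi3 R) k :=
  @Cocycle _ _ (pi3 R) k P (asboolT (conj hP dP)).

Lemma cocycle_closed k (Z : cocycle (pi3 R) k) : homog k Z /\ d Z = 0.
Proof. exact: (asboolW (cocycleP Z)). Qed.

Lemma represents_closed k (a : H k) P : represents a P -> homog k P /\ d P = 0.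
Proof. by case=> Z <- _; exact: cocycle_closed. Qed.

Lemma coclass0 k : coclass (0 : cocycle (pi3 R) k) = 0.
Proof. by apply: (@addrI _ (coclass 0)); rewrite -coclassD !addr0. Qed.

Lemma represents0 k P : homog k P -> d P = 0 -> coboundary_mv (pi3 R) k P ->
  represents (0 : H k) P.
Proof.
move=> hP dP bP; exists (mk_cocycle hP dP) => //.
by rewrite -coclass0; apply/coclass_eq; rewrite subr0.
Qed.

Lemma represents0_exact k Q : homog k Q -> represents (0 : H k.+1) (d Q).
Proof.
move=> hQ; apply: represents0; [exact: homog_dpi|exact: dpi3_dpi3|].
by exists Q.
Qed.

Lemma represents0_zero k : represents (0 : H k) 0.
Proof.
apply: represents0; [exact: homog0|exact: schouten0|].
by case: k => //= k; exists 0; [exact: homog0|rewrite /dpi schouten0].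
Qed.

Lemma represents0_ge3 k P : (2 < k)%N -> homog k P -> represents (0 : H k) P.
Proof.
move=> k2 hP; have [k3|k3] := ltnP 3 k.
  by rewrite (homog_gt3 k3 hP); exact: represents0_zero.
have k3E : k = 3 by apply/eqP; rewrite eqn_leq k3.
subst k; have [Q hQ ->] := homog3_exact hP; exact: represents0_exact.
Qed.

Lemma closed0_cst P : homog 0 P -> d P = 0 -> exists l, P = fun_mv (cst3 l).
Proof. by move=> /homog0E -> /casimir_cst ->; eexists. Qed.

Lemma schouten_cstl l Q : schouten (fun_mv (cst3 l)) Q = 0.
Proof.
rewrite /schouten big1 // => i _; rewrite (rcontr_homog0 _ (homog_fun _)) wedge0l.
rewrite partial_mvZ partial_mv_basis partial_constf scaler0 scale0r addr0.
by rewrite wedge0l subr0.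
Qed.

Lemma represents_wedge0 p q (a : H p) (b : H q) P Q : (0 < p)%N -> (0 < q)%N ->
  represents a P -> represents b Q -> represents (0 : H (p + q)) (wedge P Q).
Proof.
move=> p0 q0 /represents_closed[hP dP] /represents_closed[hQ dQ].
have [pq|pq] := ltnP 2 (p + q).
  by apply: represents0_ge3 => //; exact: homog_wedge.
have p1 : p = 1 by lia.
have q1 : q = 1 by lia.
subst p q.
have [l [m [f ->]]] := cocycle1_normal hP dP.
have [l' [m' [g ->]]] := cocycle1_normal hQ dQ.
have [Y hY ->] := wedge_normal1 l m f l' m' g; exact: represents0_exact.
Qed.

Lemma schouten11_exact P Q : homog 1 P -> d P = 0 -> homog 1 Q -> d Q = 0 ->
  exists2 Y, homog 0 Y & schouten P Q = d Y.
Proof.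
move=> hP dP hQ dQ.
have [l [m [f PE]]] := cocycle1_normal hP dP.
have [l' [m' [g ->]]] := cocycle1_normal hQ dQ.
rewrite schoutenD schouten_dpi_fun // [in X in X + _]PE schouten_normal1 -dpiD.
eexists; last by [].
by apply: homogD; [exact: homog_fun|exact: (homog_schouten hP (homog_fun g))].
Qed.

Lemma schouten12_exact P Q : homog 1 P -> d P = 0 -> homog 2 Q -> d Q = 0 ->
  exists2 Y, homog 1 Y & schouten P Q = d Y.
Proof.
move=> hP dP hQ dQ.
have [l [m [f PE]]] := cocycle1_normal hP dP.
have [c [Y [hY ->]]] := cocycle2_normal hQ dQ.
rewrite schoutenD schouten_dpi_vect // schoutenZ schouten_cst wedge0l addr0.
rewrite [in X in X + _]PE schouten_normal1_ydxdz -dpi_cstZ -dpiD.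
eexists; last by [].
apply: homogD; last exact: (homog_schouten hP hY).
by apply: homogZ; exact: homog_vect.
Qed.

Lemma represents_schouten0 p q (a : H p) (b : H q) P Q :
  represents a P -> represents b Q ->
  represents (0 : H (p + q).-1) (schouten P Q).
Proof.
move=> /represents_closed[hP dP] /represents_closed[hQ dQ].
have [pq|pq] := ltnP 2 (p + q).-1.
  by apply: represents0_ge3 => //; exact: homog_schouten.
case: p hP pq a => [|p] hP pq a.
  have [l ->] := closed0_cst hP dP.
  by rewrite schouten_cstl; exact: represents0_zero.
case: q hQ pq b => [|q] hQ pq b.
  have [l ->] := closed0_cst hQ dQ.
  by rewrite schouten_cst; exact: represents0_zero.
have : ((p = 0 /\ q = 0) \/ (p = 0 /\ q = 1) \/ (p = 1 /\ q = 0))%N by lia.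
case=> [[? ?]|[[? ?]|[? ?]]]; subst p q.
- have [Y hY ->] := schouten11_exact hP dP hQ dQ; exact: represents0_exact.
- have [Y hY ->] := schouten12_exact hP dP hQ dQ; exact: represents0_exact.
rewrite (schouten21 hP hQ); have [Y hY ->] := schouten12_exact hQ dQ hP dP.
by rewrite -dpiN; apply: represents0_exact; exact: homogN.
Qed.

Lemma is_casimir_cst l : cst3 l \in is_casimir (pi3 R).
Proof. by apply/is_casimirP; exact: schouten_cst. Qed.

Lemma casimirE (f : A) : f \in is_casimir (pi3 R) <-> exists l, f = cst3 l.
Proof.
split=> [/is_casimirP/casimir_cst ->|[l ->]]; first by eexists.
exact: is_casimir_cst.
Qed.

Definition const_casimir l : casimir (pi3 R) := Casimir (is_casimir_cst l).

Lemma casimir_constP (c : casimir (pi3 R)) : exists l, c = const_casimir l.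
Proof.
have [l cE] := (casimirE c).1 (casimirP c).
by exists l; apply/val_inj.
Qed.

Lemma cohomology0_cst (a : H 0) : exists! l : R, represents a (fun_mv (cst3 l)).
Proof.
have [hZ dZ] := cocycle_closed (repr a).
have [l ZE] := closed0_cst hZ dZ.
exists l; split; first by exists (repr a); rewrite ?coclass_surj.
move=> m [Z ZmE /esym]; rewrite -(coclass_surj a) => /coclass_eq /= /eqP.
rewrite subr_eq0 ZE ZmE => /eqP /(congr1 (fun P : MV => P (bset false false false))).
by rewrite !fun_mv_bset0 => /(congr1 (fun f : A => f 0)).
Qed.

Lemma cohomology3_0 (a : H 3) : a = 0.
Proof.
have [hZ dZ] := cocycle_closed (repr a).
have [Q hQ E] := homog3_exact hZ.
rewrite -(coclass_surj a) -coclass0; apply/coclass_eq; rewrite subr0.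
by exists Q.
Qed.

Definition xdy_cocycle : cocycle (pi3 R) 1 := mk_cocycle (homog_xdy R) (dpi_xdy R).
Definition dz_cocycle : cocycle (pi3 R) 1 := mk_cocycle (homog_pd R _) (dpi_dz R).
Definition ydxdz_cocycle : cocycle (pi3 R) 2 :=
  mk_cocycle (homog_ydxdz R) (dpi_ydxdz R).

Lemma cohomology1_basis : is_basis [:: coclass xdy_cocycle; coclass dz_cocycle].
Proof.
set e := [:: _; _].
have sumE (c : {ffun 'I_(size e) -> casimir (pi3 R)}) :
    \sum_(i < size e) c i *: e`_i = coclass (cocycle_act (c ord0) xdy_cocycle +
      cocycle_act (c (lift ord0 ord0)) dz_cocycle).
  by rewrite big_ord_recl big_ord1 coclassD -!coclass_act.
move=> v; rewrite -(coclass_surj v); have [hZ dZ] := cocycle_closed (repr v).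
have [l [m [f ZE]]] := cocycle1_normal hZ dZ.
pose c : {ffun 'I_(size e) -> casimir (pi3 R)} :=
  [ffun i => if i == ord0 then const_casimir l else const_casimir m].
have vE : coclass (repr v) = \sum_(i < size e) c i *: e`_i.
  rewrite sumE !ffunE /=; apply/coclass_eq; exists (fun_mv f); first exact: homog_fun.
  by rewrite /= ZE /normal1 addrAC subrr add0r.
exists c; split=> // c'; rewrite vE !sumE => /coclass_eq[Q hQ /=].
have [l1 El1] := casimir_constP (c' ord0); have [m1 Em1] := casimir_constP (c' (lift ord0 ord0)).
rewrite !ffunE El1 Em1 /= opprD addrACA -!scalerBl => E.
have E' : cst3 (l - l1) *: xdy + cst3 (m - m1) *: dz R = d Q.
  rewrite -E; congr (_ *: _ + _ *: _); exact: Cinf_eq.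
have [/eqP ll /eqP mm] := coboundary1_eq0 hQ E'.
rewrite subr_eq0 in ll; rewrite subr_eq0 in mm.
apply/ffunP => i; rewrite ffunE; have [->|i0] := eqVneq i ord0.
  by rewrite El1 (eqP ll).
have -> : i = lift ord0 ord0.
  by apply/val_inj; case: i i0 => [[|[|//]]].
by rewrite Em1 (eqP mm).
Qed.

Lemma cohomology2_basis : is_basis [:: coclass ydxdz_cocycle].
Proof.
set e := [:: _].
have sumE (c : {ffun 'I_(size e) -> casimir (pi3 R)}) :
    \sum_(i < size e) c i *: e`_i = coclass (cocycle_act (c ord0) ydxdz_cocycle).
  by rewrite big_ord1 -coclass_act.
move=> v; rewrite -(coclass_surj v); have [hZ dZ] := cocycle_closed (repr v).
have [l [Y [hY ZE]]] := cocycle2_normal hZ dZ.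
pose c : {ffun 'I_(size e) -> casimir (pi3 R)} := [ffun=> const_casimir l].
have vE : coclass (repr v) = \sum_(i < size e) c i *: e`_i.
  rewrite sumE ffunE; apply/coclass_eq; exists Y => //.
  by rewrite /= ZE addrAC subrr add0r.
exists c; split=> // c'; rewrite vE !sumE => /coclass_eq[Q hQ /=].
have [l1 El1] := casimir_constP (c' ord0).
rewrite !ffunE El1 /= -!scalerBl => E.
have E' : cst3 (l - l1) *: ydxdz = d Q.
  rewrite -E; congr (_ *: _); exact: Cinf_eq.
have /eqP := coboundary2_eq0 hQ E'; rewrite subr_eq0 => /eqP ll.
by apply/ffunP => i; rewrite ffunE ord1 El1 ll.
Qed.

End CohomologyClasses.

Theorem mainTheorem5 (R : realType) :
  [/\ (* H^0 *)
      (forall f : Cinf R 3, f \in is_casimir (pi3 R) <-> exists c : R, f = constf 3 c)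
      /\ (forall a : cohomology (pi3 R) 0,
            exists! c : R, represents a (fun_mv (constf 3 c))),
      (* H^1 *)
      exists e1 e2 : cohomology (pi3 R) 1,
        [/\ represents e1 (cx R *: dy R), represents e2 (dz R)
          & is_basis [:: e1; e2]],
      (* H^2 *)
      exists e : cohomology (pi3 R) 2,
        represents e (cy R *: wedge (dx R) (dz R)) /\ is_basis [:: e],
      (* H^3 *)
      forall a : cohomology (pi3 R) 3, a = 0
    & (* wedge product and Schouten-Nijenhuis bracket *)
      (forall (p q : nat) (a : cohomology (pi3 R) p) (b : cohomology (pi3 R) q)
              (P Q : multivector R 3),
         (0 < p)%N -> (0 < q)%N -> represents a P -> represents b Q ->
         represents (0 : cohomology (pi3 R) (p + q)%N) (wedge P Q))
      /\ (forall (p q : nat) (a : cohomology (pi3 R) p) (b : cohomology (pi3 R) q)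
              (P Q : multivector R 3),
         represents a P -> represents b Q ->
         represents (0 : cohomology (pi3 R) (p + q).-1%N) (schouten P Q))].
Proof.
split.
- by split; [exact: casimirE|exact: cohomology0_cst].
- exists (coclass (xdy_cocycle R)), (coclass (dz_cocycle R)).
  by split; [exists (xdy_cocycle R)|exists (dz_cocycle R)|exact: cohomology1_basis].
- exists (coclass (ydxdz_cocycle R)).
  by split; [exists (ydxdz_cocycle R)|exact: cohomology2_basis].
- exact: cohomology3_0.
- split=> [p q a b P Q|p q a b P Q]; first exact: represents_wedge0.
  exact: represents_schouten0.
Qed.
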